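(* Let $G$ be an infinite, connected, vertex-transitive, hyperbolic graph of bounded degree, and consider the two-type Richardson model on $G$ in which $\mathrm{FPP}_1$ starts from a vertex $o$ and $\mathrm{FPP}_\lambda$ starts from a single active seed $s\in V(G)\setminus\{o\}$ (for example, a neighbour of $o$). Then, for any $\lambda>0$, with positive probability both $\mathrm{FPP}_1$ and $\mathrm{FPP}_\lambda$ survive.
   Context: $d_G$ is the graph distance. For $\delta\in[0,\infty)$, $G$ is $\delta$-hyperbolic if for any three vertices $x,y,z$ and any geodesic segments $\gamma_{x,y},\gamma_{y,z},\gamma_{z,x}$ between them, every vertex $u\in\gamma_{x,y}$ is within $d_G$-distance $\delta$ of some vertex of $\gamma_{y,z}\cup\gamma_{z,x}$; $G$ is hyperbolic if it is $\delta$-hyperbolic for some $\delta<\infty$. Two-type Richardson model. Let $\{t_e\}_{e\in E(G)}$ be i.i.d. exponential random variables of mean $1$. At time $0$, $\mathrm{FPP}_1$ occupies only $o$, $\mathrm{FPP}_\lambda$ occupies only $s$, and both start spreading from time $0$: if $x$ becomes occupied by $\mathrm{FPP}_1$ (resp. $\mathrm{FPP}_\lambda$) at time $t$, then each neighbour $y$ of $x$ which is still unoccupied at time $t+t_{\{x,y\}}$ (resp. $t+t_{\{x,y\}}/\lambda$) becomes occupied at that time by $\mathrm{FPP}_1$ (resp. $\mathrm{FPP}_\lambda$). An occupied vertex keeps its type forever. A process survives if, in the limit as time tends to infinity, it occupies an infinite connected region of the graph. *)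

(* Defs.v *)
From HB Require Import structures.
From mathcomp Require Import all_boot all_order all_algebra.
From mathcomp Require Import all_classical all_reals all_analysis.
Import Order.TTheory GRing.Theory Num.Theory.
Import numFieldNormedType.Exports.

Set Implicit Arguments.
Unset Strict Implicit.
Unset Printing Implicit Defensive.

Local Open Scope classical_set_scope.
Local Open Scope ring_scope.

(** A walk from [x] to [y] is a sequence [p] with [path e x p] and [last x p = y]: its
    vertices are [x :: p] and its length is [size p]. *)

Section Graphs.
Context {V : choiceType} (e : rel V).

Definition simple_graph : Prop := symmetric e /\ irreflexive e.

Definition walk (x y : V) (p : seq V) : Prop := path e x p /\ last x p = y.

Definition connected_graph : Prop := forall x y, exists p, walk x y p.

Definition bounded_degree : Prop :=
  exists D : nat, forall x, ([set y | e x y] #<= `I_D)%card.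

Definition automorphism (f : V -> V) : Prop :=
  bijective f /\ forall x y, e (f x) (f y) = e x y.

Definition vertex_transitive : Prop :=
  forall x y, exists f, automorphism f /\ f x = y.

Definition has_walk (x y : V) (n : nat) : Prop :=
  exists2 p, walk x y p & size p = n.

(** Two vertices with no walk between them get the junk distance 0. *)
Definition gdist (x y : V) : nat :=
  if pselect (exists n, `[< has_walk x y n >]) is left h then ex_minn h else 0.

Definition geodesic (x y : V) (p : seq V) : Prop :=
  walk x y p /\ size p = gdist x y.

Definition delta_hyperbolic {R : realType} (delta : R) : Prop :=
  forall (x y z : V) (pxy pyz pzx : seq V),
    geodesic x y pxy -> geodesic y z pyz -> geodesic z x pzx ->
    forall u, u \in x :: pxy ->
      exists2 v, v \in (y :: pyz) ++ (z :: pzx) & (gdist u v)%:R <= delta.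

Definition hyperbolic (R : realType) : Prop :=
  exists2 delta : R, 0 <= delta & delta_hyperbolic delta.

Definition connected_region (C : set V) : Prop :=
  forall x y, C x -> C y -> exists2 p, walk x y p & [set` x :: p] `<=` C.

Definition edges : set (set V) :=
  [set E | exists x y, e x y /\ E = [set x; y]].

End Graphs.

Section IID.
Context d {T : measurableType d} {R : realType} (P : probability T R).

(** Only the variables [X i] with [i] in [D] are concerned. *)
Definition mutually_independent {I : choiceType} (D : set I)
    (X : I -> {RV P >-> R}) : Prop :=
  forall (s : seq I) (B : I -> set R),
    uniq s -> [set` s] `<=` D -> (forall i, measurable (B i)) ->
    P (\bigcap_(i in [set` s]) (X i @^-1` B i)) =
      (\prod_(i <- s) P (X i @^-1` B i))%E.

Definition iid_exponential1 {I : choiceType} (D : set I)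
    (X : I -> {RV P >-> R}) : Prop :=
  mutually_independent D X /\
  forall i, D i -> forall B : set R, measurable B ->
    distribution P (X i) B = exponential_prob 1 B.

End IID.

Inductive fpp_type : Set := FPP1 | FPPlam.

Definition rate {R : realType} (lam : R) (i : fpp_type) : R :=
  if i is FPP1 then 1 else lam.

(** A history records, for each vertex, the time at which it becomes occupied
    ([+oo] if it never does) and the type which then occupies it, forever; the
    type is meaningless when the time is [+oo]. *)
Record history (V : choiceType) (R : realType) := History {
  occ_time : V -> \bar R ;
  occ_type : V -> fpp_type }.

Section Richardson.
Context {V : choiceType} {R : realType} (e : rel V) (lam : R) (o s : V).

(** The time at which [x], once occupied, reaches its neighbour [y]; the
    passage time of the edge {x, y} is [w [set x; y]]. *)
Definition arrival (w : set V -> R) (h : history V R) (x y : V) : \bar R :=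
  (occ_time h x + (w [set x; y] / rate lam (occ_type h x))%:E)%E.

(** [rich_spread]: a vertex still unoccupied just before an occupied neighbour
    reaches it becomes occupied at that time.  [rich_source]: this is the only
    way to become occupied, and the type is inherited from the neighbour.
    If neighbours of both types reach [y] at the same time (a null event), the
    rules allow either type. *)
Record richardson (w : set V -> R) (h : history V R) : Prop := {
  rich_ge0 : forall x, (0 <= occ_time h x)%E ;
  rich_seed1 : occ_time h o = 0%E /\ occ_type h o = FPP1 ;
  rich_seedlam : occ_time h s = 0%E /\ occ_type h s = FPPlam ;
  rich_spread : forall x y, e x y -> (occ_time h y <= arrival w h x y)%E ;
  rich_source : forall y, y != o -> y != s -> (occ_time h y < +oo)%E ->
    exists x, [/\ e x y, occ_time h y = arrival w h x y
                & occ_type h y = occ_type h x] }.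

Definition final_region (h : history V R) (i : fpp_type) : set V :=
  [set x | (occ_time h x < +oo)%E /\ occ_type h x = i].

Definition survives (h : history V R) (i : fpp_type) : Prop :=
  exists C : set V,
    [/\ C `<=` final_region h i, infinite_set C & connected_region e C].

(** For passage times outside a null set the rules have exactly one history
    (up to the type of never occupied vertices).  On the exceptional null set
    they may have none or several: the event requires that there be one and
    that every one of them have both types surviving. *)
Definition both_survive (w : set V -> R) : Prop :=
  (exists h, richardson w h) /\
  (forall h, richardson w h -> survives h FPP1 /\ survives h FPPlam).

End Richardson.

(** "[E] has positive probability", without presupposing that [E] is measurable:
    for an [E] which differs from a measurable set by a null set this says that
    the completion of [P] gives [E] a positive mass. *)
Definition positive_probability d {T : measurableType d} {R : realType}
    (P : probability T R) (E : set T) : Prop :=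
  exists A : set T, [/\ measurable A, A `<=` E & (0 < P A)%E].

(* Main.v *)
Require Import Defs.
From HB Require Import structures.
From mathcomp Require Import all_boot all_order all_algebra.
From mathcomp Require Import all_classical all_reals all_analysis.
From mathcomp Require Import zify ring lra.
Import Order.TTheory GRing.Theory Num.Theory.
Import numFieldNormedType.Exports.

(** Why both types survive with positive probability.

    Type [i] survives because it can follow a geodesic ray, although its
    opponent may be much faster.  Suppose that type [i] owns a large ball of
    radius [r0] around the start of a geodesic ray, and that the opponent sits
    behind that ball.  While type [i] runs along the ray, it keeps widening
    the region around it: it fills the ball of radius [r0 + j] around the
    point at distance [2 * j] within a time that is polynomial in [r0 + j].  In
    a hyperbolic graph a path that avoids a ball met by the geodesic between
    its ends has length exponential in the radius ([path_near_geodesic]), so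
    an opponent who wants to get into the [j]th ball has to make a detour,
    around an earlier ball of almost the same radius, that takes it a time
    exponential in [r0 + j].  If [r0] is large enough for the given speeds,
    the detour takes too long for every [j] at once, and by induction on [j] no
    point of the ray is ever lost ([branch_or_pass], [cone_filled]).

    The argument needs two rays that start from [o] and [s] along disjoint
    trajectories and diverge from each other ([diverging_ex]).  They come from
    bi-infinite geodesics through [o] and [s], which exist by transitivity and
    compactness; the only obstruction to splitting one such line between [o]
    and [s] is that both are cut vertices, and then pieces of both lines fit
    together.  The ball of type [i] is taken far out on its ray, and the
    passage times inside of the two initial regions [core_of] are forced to be
    tiny, so that both regions are filled before either type leaves its own.

    What remains is a statement on the passage times, [good_weights]:
    they are tiny inside of the initial regions, a long simple path
    takes a time at least linear in its length, and a single edge takes a time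
    at most linear in its distance from the start of a ray.  The latter two
    properties fail somewhere with probability small enough for a union bound
    over all paths, and only finitely many edges near the initial regions
    need to be prescribed.  By independence this costs a positive factor
    ([union_bound], [good_weights_ex]).

    The linear lower bound also excludes explosion.  Hence every occupied
    vertex has a genealogy that goes back to a seed ([genealogy]), and a history
    exists: vertices can be occupied one after the other, in the order in which
    they are reached ([richardson_ex]). *)

Set Implicit Arguments.
Unset Strict Implicit.
Unset Printing Implicit Defensive.

Local Open Scope classical_set_scope.
Local Open Scope ring_scope.

(** * The graph metric *)

Section Metric.
Local Open Scope nat_scope.
Context {V : choiceType} {e : rel V}.
Hypotheses (esym : symmetric e) (econn : connected_graph e).
Local Notation d := (gdist e).

Lemma walk_cat x y z p q :
  walk e x y p -> walk e y z q -> walk e x z (p ++ q).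
Proof. by move=> [pp lp] [pq lq]; split; rewrite ?cat_path ?last_cat lp ?pp. Qed.

Lemma walk_rev x y p : walk e x y p -> walk e y x (rev (belast x p)).
Proof.
move=> [pp <-]; split; last by case: p pp => //= z p _; rewrite rev_cons last_rcons.
by rewrite rev_path; under eq_path do rewrite esym.
Qed.

Lemma gdist_geodesic x y : exists p, geodesic e x y p.
Proof.
rewrite /geodesic /gdist; case: pselect => [h|noh].
  by case: ex_minnP => n /asboolP[p wp <-] _; exists p.
by case: noh; have [p wp] := econn x y; exists (size p); apply/asboolP; exists p.
Qed.

Lemma gdist_min {x y p} : walk e x y p -> d x y <= size p.
Proof.
move=> wp; rewrite /gdist; case: pselect => [h|//].
by case: ex_minnP => n _; apply; apply/asboolP; exists p.
Qed.

Lemma gdistxx x : d x x = 0.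
Proof. by apply/eqP; rewrite -leqn0; apply: (@gdist_min _ _ [::]). Qed.

Lemma gdist_eq0 x y : d x y = 0 -> x = y.
Proof. by have [[|z p] [[_ <-] <-]] := gdist_geodesic x y. Qed.

Lemma gdistC x y : d x y = d y x.
Proof.
suff le u v : d v u <= d u v by apply/eqP; rewrite eqn_leq !le.
have [p [wp <-]] := gdist_geodesic u v.
by have := gdist_min (walk_rev wp); rewrite size_rev size_belast.
Qed.

Lemma gdist_triangle y {x z} : d x z <= d x y + d y z.
Proof.
have [p [wp <-]] := gdist_geodesic x y; have [q [wq <-]] := gdist_geodesic y z.
by rewrite -size_cat; apply: gdist_min (walk_cat wp wq).
Qed.

Lemma gdist_edge {x y} : e x y -> d x y <= 1.
Proof. by move=> xy; apply: (@gdist_min _ _ [:: y]); split; rewrite /= ?xy. Qed.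

(** [u] lies on some geodesic from [x] to [y]; speaking of distances only spares
    the bookkeeping of geodesic segments. *)
Definition btw x y u := d x u + d u y = d x y.

Lemma btwC x y u : btw x y u <-> btw y x u.
Proof. by rewrite /btw addnC (gdistC x) (gdistC y) (gdistC x y). Qed.

Lemma geodesic_btw {x y p u} : geodesic e x y p -> u \in x :: p -> btw x y u.
Proof.
move=> [[pp lp] sp] ux; apply/eqP; rewrite eqn_leq gdist_triangle andbT -sp.
case/splitPl: ux pp lp {sp} => p1 p2 lp1; rewrite cat_path last_cat => /andP[pp1 pp2] lp2.
rewrite size_cat leq_add// gdist_min//; split=> //; rewrite -?lp1//.
Qed.

Lemma btw_geodesic {x y u} : btw x y u ->
  exists2 p, geodesic e x y p & u \in x :: p.
Proof.
have [p [wp sp]] := gdist_geodesic x u; have [q [wq sq]] := gdist_geodesic u y.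
move=> xuy; exists (p ++ q); last by rewrite -cat_cons mem_cat -wp.2 mem_last.
by split; [apply: walk_cat wp wq | rewrite size_cat sp sq].
Qed.

Lemma btw_ex n {x y} : n <= d x y -> exists2 u, btw x y u & d x u = n.
Proof.
have [p gp] := gdist_geodesic x y; have [[pp lp] sp] := gp.
rewrite -sp => lenp; pose u := last x (take n p).
have := pp; rewrite -{1}(cat_take_drop n p) cat_path => /andP[pp1 pp2].
have ux : u \in x :: p.
  by rewrite -(cat_take_drop n p) -cat_cons mem_cat mem_last.
have := geodesic_btw gp ux => xuy; exists u => //.
have le1 : d x u <= n.
  by have := @gdist_min x u (take n p) (conj pp1 erefl); rewrite size_takel.
have le2 : d u y <= size p - n.
  have := @gdist_min u y (drop n p); rewrite size_drop; apply.
  by split=> //; rewrite -last_cat cat_take_drop.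
by move: xuy; rewrite /btw -sp; lia.
Qed.

End Metric.

(** * Hyperbolic geometry *)

Section Hyperbolicity.
Local Open Scope nat_scope.
Context {V : choiceType} {e : rel V}.
Hypotheses (esym : symmetric e) (econn : connected_graph e).
Local Notation d := (gdist e).
Local Notation btw := (@btw V e).

Definition thin (del : nat) := forall x y z u, btw x y u ->
  exists2 v, btw y z v \/ btw z x v & d u v <= del.

Lemma hyperbolic_thin (R : realType) :
  hyperbolic e R -> exists2 del, 0 < del & thin del.
Proof.
move=> [delta delta0 hyp]; exists (Num.bound delta).
  by rewrite -(ltr_nat R); apply: le_lt_trans delta0 (archi_boundP delta0).
move=> x y z u /(btw_geodesic econn)[pxy gxy uxy].
have [pyz gyz] := gdist_geodesic econn y z.
have [pzx gzx] := gdist_geodesic econn z x.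
have [v vin duv] := hyp x y z _ _ _ gxy gyz gzx u uxy.
exists v; last first.
  by rewrite -(ler_nat R) (le_trans duv)// ltW// archi_boundP.
by move: vin; rewrite mem_cat => /orP[/(geodesic_btw econn gyz)|
  /(geodesic_btw econn gzx)]; [left|right].
Qed.

Context {del : nat}.
Hypothesis hthin : thin del.

(** A path of length [2 ^ k] can be halved [k] times, and each halving replaces a
    geodesic by two sides of a thin triangle.  Hence a path that stays far from
    a geodesic between its ends is exponentially long. *)
Lemma path_near_geodesic k x p u : path e x p -> size p <= 2 ^ k ->
  btw x (last x p) u -> exists2 v, v \in x :: p & d u v <= del * k.
Proof.
elim: k x p u => [|k IHk] x p u pp sp xu.
  have := gdist_min (conj pp erefl : walk e x _ p); rewrite -xu.
  have [/gdist_eq0-> // _|xu0] := eqVneq (d x u) 0.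
    by exists u; rewrite ?mem_head ?gdistxx.
  have [/gdist_eq0-> // _|uy0] := eqVneq (d u (last x p)) 0.
    by exists (last x p); rewrite ?mem_last ?gdistxx.
  by move: sp xu0 uy0; rewrite expn0; lia.
have /andP[pp1 pp2] : path e x (take (2 ^ k) p) &&
    path e (last x (take (2 ^ k) p)) (drop (2 ^ k) p).
  by rewrite -cat_path cat_take_drop.
set m := last x _ in pp2.
have lm : last m (drop (2 ^ k) p) = last x p by rewrite /m -last_cat cat_take_drop.
have [v [v1|v2] duv] := hthin m xu.
- have [||v' v'in dvv'] := IHk m (drop (2 ^ k) p) v pp2.
  + by rewrite size_drop; move: sp; rewrite expnS; lia.
  + by rewrite lm; apply/(btwC esym econn).
  exists v'; last by have := gdist_triangle econn v (x := u) (z := v'); lia.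
  move: v'in; rewrite inE => /orP[/eqP->|v'in].
    by rewrite -(cat_take_drop (2 ^ k) p) -cat_cons mem_cat /m mem_last.
  by rewrite inE (mem_drop v'in) orbT.
- have [||v' v'in dvv'] := IHk x (take (2 ^ k) p) v pp1.
  + by rewrite size_take; case: ifP => //; lia.
  + by apply/(btwC esym econn).
  exists v'; last by have := gdist_triangle econn v (x := u) (z := v'); lia.
  by rewrite -(cat_take_drop (2 ^ k) p) -cat_cons mem_cat v'in.
Qed.

(** Think of [z] as a far point of a ray, of [y] as an earlier point of that
    ray, and of [s] as a point behind the ray, so that geodesics from [s] to
    [z] pass near [y].  Then a geodesic from [s] to a third point [x] passes
    near [y] as well, unless [x] branches off the ray before [y], and then
    going from [x] to [z] essentially means going through [y]. *)
Lemma branch_or_pass k s x y z u p :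
    btw s z u -> d y u <= del -> path e x p -> last x p = s -> size p <= 2 ^ k ->
  d x y + d y z <= d x z + 4 * del \/
  exists2 v, v \in x :: p & d y v <= del * (k + 2).
Proof.
move=> szu yu pp lp sp; have [v [v1|v2] uv] := hthin x szu.
- left; have := gdist_triangle econn v (x := x) (z := y).
  have := gdist_triangle econn v (x := y) (z := z).
  have := gdist_triangle econn u (x := y) (z := v).
  rewrite (gdistC esym econn v y) (gdistC esym econn v z).
  by move: v1; rewrite /btw (gdistC esym econn x z) (gdistC esym econn x v); lia.
- right; have [|v' v'in vv'] := path_near_geodesic pp sp (u := v).
    by rewrite lp.
  exists v' => //; have := gdist_triangle econn v (x := y) (z := v').
  by have := gdist_triangle econn u (x := y) (z := v); lia.
Qed.

(** A point [s] close to the start of a long geodesic is behind all its far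
    points: the thin triangle with a short side at [s] gains nothing there. *)
Lemma behind_of_near s b y z : btw b z y -> d s b + del < d b y ->
  exists2 u, btw s z u & d y u <= del.
Proof.
move=> bzy far; have [u [u1|u2] yu] := hthin s bzy.
  by exists u => //; apply/(btwC esym econn).
exfalso; have := gdist_triangle econn u (x := b) (z := y).
by move: u2; rewrite /btw (gdistC esym econn u y) (gdistC esym econn b u); lia.
Qed.

End Hyperbolicity.

(** * Balls and path enumeration *)

Section BoundedDegree.
Local Open Scope nat_scope.
Context {V : choiceType} {e : rel V}.

Lemma bounded_degree_nbr : bounded_degree e ->
  exists (nb : V -> seq V) (D : nat),
    (forall x y, (y \in nb x) = e x y) /\ (forall x, size (nb x) <= D).
Proof.
move=> [D hD]; suff /choice[nb hnb] : forall x, exists s : seq V,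
    (forall y, (y \in s) = e x y) /\ size s <= D.
  by exists nb, D; split=> x; have [] := hnb x.
move=> x; have fin : finite_set [set y | e x y].
  exact: card_le_finite (hD x) (finite_II D).
exists (finmap.enum_fset (fset_set [set y | e x y])); split=> [y|].
  have -> : e x y = (y \in [set y | e x y]) by apply/idP/idP; rewrite inE.
  by rewrite -(in_fset_set fin).
have := hD x; rewrite -[X in (X #<= _)%card -> _](fset_setK fin).
have h := introT (@card_eq_fsetP _ (fset_set [set y | e x y]) _) erefl.
by rewrite (card_le_eql h) card_le_II.
Qed.

End BoundedDegree.

Section Enumeration.
Local Open Scope nat_scope.
Context {V : choiceType} {e : rel V} (nb : V -> seq V) (D : nat).
Hypotheses (esym : symmetric e) (econn : connected_graph e).
Hypotheses (nbE : forall x y, (y \in nb x) = e x y)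
           (nbD : forall x, size (nb x) <= D).
Local Notation d := (gdist e).

Fixpoint ball n x : seq V :=
  if n is m.+1 then flatten [seq y :: nb y | y <- ball m x] else [:: x].

Fixpoint paths n x : seq (seq V) :=
  if n is m.+1 then flatten [seq map (cons y) (paths m y) | y <- nb x]
  else [:: [::]].

Lemma mem_ball n x y : (y \in ball n x) = (d x y <= n).
Proof.
elim: n y => [|n IHn] y /=.
  rewrite inE leqn0; apply/eqP/eqP => [->|/(gdist_eq0 econn)//].
  exact: gdistxx.
apply/flatten_mapP/idP => [[z]|le].
  rewrite IHn inE => dxz /orP[/eqP->|]; first exact: leqW.
  rewrite nbE => /gdist_edge; have := gdist_triangle econn z (x := x) (z := y).
  by move: dxz; lia.
have [dn|dn] := leqP (d x y) n.
  by exists y; rewrite ?IHn// mem_head.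
have [u xuy dxu] := btw_ex econn (ltnW dn).
exists u; first by rewrite IHn dxu.
have := gdist_geodesic econn u y; rewrite /geodesic => -[p [wp]].
have -> : d u y = 1 by move: xuy; rewrite /btw; lia.
case: p wp => [//|z [|//]] [/= + <- _]; rewrite andbT => ez.
by rewrite inE nbE ez orbT.
Qed.

Lemma size_ball n x : size (ball n x) <= D.+1 ^ n.
Proof.
elim: n => //= n IHn; rewrite size_flatten /shape -map_comp expnSr.
apply: leq_trans (leq_mul IHn (leqnn _)).
elim: (ball n x) => //= y s IHs; rewrite mulSn leq_add//.
by rewrite ltnS nbD.
Qed.

Lemma mem_paths n x p : (p \in paths n x) = path e x p && (size p == n).
Proof.
elim: n x p => [|n IHn] x p /=.
  by rewrite inE; case: p => //= y p; rewrite andbF.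
apply/flatten_mapP/idP => [[y yx /mapP[q + ->]]|].
  by rewrite IHn /= -nbE yx => /andP[-> /eqP->] /=.
case: p => [//|y p] /= /andP[/andP[xy pp] sp]; exists y; first by rewrite nbE.
by rewrite map_f// IHn pp.
Qed.

Lemma size_paths n x : size (paths n x) <= D.+1 ^ n.
Proof.
elim: n x => //= n IHn x; rewrite size_flatten /shape -map_comp expnS.
apply: leq_trans (leq_mul (leqW (nbD x)) (leqnn _)).
elim: (nb x) => //= y s IHs; rewrite mulSn leq_add//.
by rewrite size_map.
Qed.

Lemma infinite_far : infinite_set [set: V] -> forall n x, exists y, n <= d x y.
Proof.
move=> Vinf n x; apply: contra_notP Vinf => /forallNP noy.
apply: (@sub_finite_set _ _ [set` ball n x]); last exact: finite_seq.
by move=> y _ /=; rewrite mem_ball ltnW// ltnNge; apply/negP/noy.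
Qed.

End Enumeration.

(** * Bi-infinite geodesics *)

Section Lines.
Local Open Scope nat_scope.
Context {V : choiceType} {e : rel V}.
Hypotheses (esym : symmetric e) (econn : connected_graph e).
Local Notation d := (gdist e).

Lemma automorphism_gdist f x y : automorphism e f -> d (f x) (f y) = d x y.
Proof.
suff le g u v : (forall a b, e (g a) (g b) = e a b) -> d (g u) (g v) <= d u v.
  move=> [[g fK gK] ef]; apply/eqP; rewrite eqn_leq le//=.
  by rewrite -{1}(fK x) -{1}(fK y) le// => a b; rewrite -ef !gK.
move=> eg; have [p [[pp lp] <-]] := gdist_geodesic econn u v.
rewrite -(size_map g); apply: gdist_min; split; last by rewrite last_map lp.
by rewrite path_map; under eq_path do rewrite /= eg.
Qed.

Lemma gdist_lipschitz (f : nat -> V) n : (forall k, k < n -> e (f k) (f k.+1)) ->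
  forall k l, k <= l <= n -> d (f k) (f l) <= l - k.
Proof.
move=> ef k; elim=> [|l IHl] /andP[kl ln].
  by move: kl; rewrite leqn0 => /eqP->; rewrite gdistxx.
have [->|klne] := eqVneq k l.+1; first by rewrite gdistxx.
have := gdist_triangle econn (f l) (x := f k) (z := f l.+1).
have := gdist_edge (ef _ ln); have := IHl ltac:(lia); lia.
Qed.

Definition line (l : int -> V) := forall i j, d (l i) (l j) = `|i - j|%N.

Lemma geodesic_nth x y p : geodesic e x y p ->
  forall k l, k <= l <= size p -> d (nth x (x :: p) k) (nth x (x :: p) l) = l - k.
Proof.
move=> [[pp lp] sp] k l kl; pose f := nth x (x :: p).
have lip := @gdist_lipschitz f (size p) ((pathP x pp)).
apply/eqP; rewrite eqn_leq lip//=.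
have := gdist_triangle econn (f k) (x := x) (z := y).
have := gdist_triangle econn (f l) (x := f k) (z := y).
have := lip 0 k ltac:(lia); have := lip l (size p) ltac:(lia).
have -> : f (size p) = y by rewrite /f -lp; rewrite -last_nth.
have -> : f 0 = x by [].
by rewrite -sp -/(f k) -/(f l); lia.
Qed.

Lemma ultra_finite (U : set_system nat) (g : nat -> V) (s : seq V) :
  UltraFilter U -> U [set n | g n \in s] -> exists v, U [set n | g n = v].
Proof.
move=> UU; elim: s => [|v s IHs] Us.
  by exfalso; apply: (@filter_not_empty _ U _); apply: filterS Us.
have [Uv|Uv] := in_ultra_setVsetC [set n | g n = v] UU; first by exists v.
apply: IHs; apply: filterS2 Us Uv => n /=.
by rewrite inE => /orP[/eqP|].
Qed.

Context (nb : V -> seq V) (D : nat).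
Hypotheses (nbE : forall x y, (y \in nb x) = e x y).
Hypotheses (Vinf : infinite_set [set: V]) (etrans : vertex_transitive e).

(** By transitivity long geodesics can be centred at [o]; these are
    compactly many, so some limit along an ultrafilter exists. *)
Lemma line_through o : exists2 l, line l & l 0%R = o.
Proof.
have seg n : exists l : int -> V, l 0%R = o /\
    forall i j : int, (`|i| <= n)%N -> (`|j| <= n)%N -> d (l i) (l j) = `|i - j|%N.
  have [y dy] := infinite_far econn nbE Vinf (n + n) o.
  have [u _ du] := btw_ex econn dy.
  have [p gp] := gdist_geodesic econn o u.
  have [f [af fo]] := etrans (nth o (o :: p) n) o.
  exists (fun i : int => f (nth o (o :: p) (absz (n%:Z + i)%R))); split.
    by rewrite addr0 fo.
  move=> i j ni nj; rewrite automorphism_gdist//.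
  wlog ij : i j ni nj / (i <= j)%R.
    move=> wl; case/orP: (le_total i j) => [|/(wl _ _ nj ni)]; first exact: wl.
    by rewrite (gdistC esym econn) => ->; lia.
  by rewrite (geodesic_nth gp)// ?gp.2 ?du; lia.
have /choice[L hL] := seg.
have [U [UU sU]] := @ultraFilterLemma nat \oo _.
have /choice[l hl] : forall i : int, exists v, U [set n | L n i = v].
  move=> i; apply: (@ultra_finite _ _ (ball nb `|i|%N o)) => //.
  apply: sU; exists `|i|%N => // n /= ni.
  by rewrite (mem_ball econn nbE) -(hL n).1 (hL n).2//; lia.
exists l => [i j|]; last first.
  have [n ln] := filter_ex (hl 0%R).
  by rewrite -ln (hL n).1.
have lU : U [set n | (`|i| <= n)%N /\ (`|j| <= n)%N].
  by apply: sU; exists (`|i| + `|j|)%N => // n /= ?; split; lia.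
have [n [[ni nj] [<- <-]]] := filter_ex (filterI lU (filterI (hl i) (hl j))).
exact: (hL n).2.
Qed.

End Lines.

(** * Diverging rays from the two seeds *)

Section Diverging.
Local Open Scope nat_scope.
Context {V : choiceType} {e : rel V}.
Hypotheses (esym : symmetric e) (econn : connected_graph e).
Local Notation d := (gdist e).

Lemma gdist1 x y : d x y = 1 -> e x y.
Proof.
have [p [wp <-]] := gdist_geodesic econn x y.
by case: p wp => [//|z [|//]] [/= + <- _]; rewrite andbT.
Qed.

Lemma path_ray (f : nat -> V) k n : (forall j, e (f j) (f j.+1)) ->
  path e (f k) (map f (iota k.+1 n)) /\ last (f k) (map f (iota k.+1 n)) = f (k + n).
Proof.
move=> ef; elim: n k => [|n IHn] k /=; first by rewrite addn0.
by have [-> ->] := IHn k.+1; rewrite ef addSnnS.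
Qed.

Lemma path_first_hit (T : eqType) (r : rel T) (A : pred T) x p :
    path r x p -> ~~ A x -> A (last x p) ->
  exists z q, [/\ path r x (rcons q z), A z, {in x :: q, forall y, ~~ A y}
    & exists p', p = rcons q z ++ p'].
Proof.
elim: p x => [|y p IHp] x /=; first by move=> _ /negP.
move=> /andP[xy pp] xA lA; have [yA|yA] := boolP (A y).
  exists y, [::]; rewrite /= xy; split=> // [z|]; last by exists p.
  by rewrite inE => /eqP->.
have [z [q [pq zA qA [p' ->]]]] := IHp y pp yA lA.
exists z, (y :: q); rewrite /= xy; split=> // [u|]; last by exists p'.
by rewrite inE => /orP[/eqP->//|]; apply: qA.
Qed.

(** Two rays that go apart at full speed, reached from [o] and [s] along
    trajectories that do not meet. *)
Record diverging (o s : V) (al be : nat -> V) (g : nat) (p q : seq V) : Prop := {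
  div_gt0 : 0 < g ;
  div_al : forall m n, m <= n -> d (al m) (al n) = n - m ;
  div_be : forall m n, m <= n -> d (be m) (be n) = n - m ;
  div_al_be : forall m n, d (al m) (be n) = m + n + g ;
  div_p : walk e o (al 0) p ;
  div_q : walk e s (be 0) q ;
  div_pq : {in o :: p, forall x, x \notin s :: q} ;
  div_p_be : {in o :: p, forall x n, x <> be n} ;
  div_q_al : {in s :: q, forall x n, x <> al n} }.

Lemma divergingC o s al be g p q :
  diverging o s al be g p q -> diverging s o be al g q p.
Proof.
case=> g0 al_ be_ ab wp wq pq pb qa; split=> //.
  by move=> m n; rewrite (gdistC esym econn) ab; lia.
by move=> x xq; apply: contraL xq => /pq.
Qed.

Lemma lineN (l : int -> V) : line (e := e) l -> line (e := e) (fun i => l (- i)%R).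
Proof. by move=> ll i j; rewrite ll; lia. Qed.

Lemma line_inj (l : int -> V) i j : line (e := e) l -> l i = l j -> i = j.
Proof. by move=> ll lij; have := ll i j; rewrite lij gdistxx; lia. Qed.

Lemma diverging_on_line o s (l : int -> V) k : line (e := e) l -> l 0%R = o ->
  l k = s -> s != o -> exists al be g p q, diverging o s al be g p q.
Proof.
wlog k0 : l k / (0 <= k)%R.
  move=> wl ll lo lk so; case/orP: (le_total 0%R k) => k0; first exact: (wl l k).
  by apply: (wl (fun i => l (- i)%R) (- k)%R); rewrite ?oppr_ge0 ?oppr0 ?opprK//;
    apply: lineN.
move=> ll lo lk so.
have {}k0 : (0 < k)%R.
  by rewrite lt_neqAle k0 andbT; apply: contraNneq so => k0'; rewrite -lk -k0' lo.
exists (fun m => l (- m%:Z)%R), (fun n => l (k + n%:Z)%R), `|k|%N, [::], [::].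
split; rewrite ?oppr0 ?addr0//; first lia.
- by move=> m n mn; rewrite ll; lia.
- by move=> m n mn; rewrite ll; lia.
- by move=> m n; rewrite ll; lia.
- by move=> x; rewrite !inE => /eqP->; rewrite eq_sym.
- by move=> x; rewrite inE => /eqP-> n; rewrite -lo => /(line_inj ll); lia.
- by move=> x; rewrite inE => /eqP-> n; rewrite -lk => /(line_inj ll); lia.
Qed.

(** If [s] can reach the line through [o] elsewhere than at [o], then [s] gets
    one half of the line and leaves the other half to [o]. *)
Lemma diverging_off_line o s (l : int -> V) k q : line (e := e) l -> l 0%R = o ->
    (forall i, l i <> s) -> walk e s (l k) q -> o \notin s :: q ->
  exists al be g p q, diverging o s al be g p q.
Proof.
move=> ll lo ls [pq lq] oq.
have [||z [r [pr /asboolP[j lj] rl [r' rE]]]] :=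
  @path_first_hit _ e (fun x => `[< exists i, l i = x >]) s q pq.
- by apply/asboolP => -[i]; apply: ls.
- by rewrite lq; apply/asboolP; exists k.
have oz : o != z.
  apply: contraNneq oq => ->; rewrite rE inE mem_cat mem_rcons mem_head.
  by rewrite orbT.
have or : o \notin s :: rcons r z.
  by apply: contra oq; rewrite rE inE => /orP[/eqP->|oin];
    rewrite ?mem_head// inE mem_cat oin orbT.
have {oq rE q pq lq k} j0 : j != 0%R by apply: contraNneq oz => j0; rewrite -lj j0 lo.
wlog jp : l j ll lo ls lj rl j0 / (0 < j)%R.
  move=> wl; have [jp|jn|j00] := ltrgt0P j; first exact: (wl l j); last by lia.
  apply: (wl (fun i => l (- i)%R) (- j)%R) => //; rewrite ?opprK ?oppr0 ?oppr_eq0//.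
  - exact: lineN.
  - move=> x xr; apply: contra (rl x xr) => /asboolP[i <-].
    by apply/asboolP; exists (- i)%R.
  - by rewrite oppr_gt0.
exists (fun m => l (- m%:Z)%R), (fun n => l (j + n%:Z)%R), `|j|%N, [::], (rcons r z).
split; rewrite ?oppr0 ?addr0//; first lia.
- by move=> m n mn; rewrite ll; lia.
- by move=> m n mn; rewrite ll; lia.
- by move=> m n; rewrite ll; lia.
- by split=> //; rewrite last_rcons.
- by move=> x; rewrite inE => /eqP->.
- by move=> x; rewrite inE => /eqP-> n; rewrite -lo => /(line_inj ll); lia.
- move=> x; rewrite -rcons_cons mem_rcons inE => /orP[/eqP->|xr] n xE.
    by move: xE; rewrite -lj => /(line_inj ll); lia.
  by have := rl x xr => /asboolP; apply; exists (- n%:Z)%R.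
Qed.

(** When [o] cuts [s] off the line through [o], and [s] cuts [o] off the line
    through [s], both are cut vertices and half lines can be joined through a
    geodesic from [o] to [s]. *)
Lemma diverging_cut o s (l l' : int -> V) : s != o ->
    line (e := e) l -> l 0%R = o -> line (e := e) l' -> l' 0%R = s ->
    (forall i, l i <> s) -> (forall i, l' i <> o) ->
    (forall k q, k != 0%R -> walk e s (l k) q -> o \in s :: q) ->
    (forall k q, k != 0%R -> walk e o (l' k) q -> s \in o :: q) ->
  exists al be g p q, diverging o s al be g p q.
Proof.
move=> so ll lo ll' ls lns lno cut cut'.
have ray n : exists q, walk e s (l' n%:Z) q /\ o \notin s :: q.
  have el j : e (l' j%:Z) (l' j.+1%:Z) by apply: gdist1; rewrite ll'; lia.
  have [pq lq] := path_ray 0 n el; exists (map (fun j : nat => l' j%:Z) (iota 1 n)).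
  rewrite -ls; split=> //; rewrite inE negb_or; apply/andP; split.
    by apply/eqP/nesym/lno.
  by apply/mapP => -[j _ ol]; apply: (lno j%:Z); rewrite -ol.
have dos n : d o (l' n%:Z) = d o s + n.
  have dsn : d s (l' n%:Z) = n by rewrite -ls ll'; lia.
  have [->|n0] := eqVneq n 0; first by rewrite ls addn0.
  have [q gq] := gdist_geodesic econn o (l' n%:Z).
  by have /(geodesic_btw econn gq) := cut' n%:Z q n0 gq.1; rewrite /btw dsn.
exists (fun m => l m%:Z), (fun n => l' n%:Z), (d o s), [::], [::].
split; rewrite ?lo ?ls//.
- rewrite lt0n; apply: contraNneq so => /(gdist_eq0 econn)->; exact: eqxx.
- by move=> m n mn; rewrite ll; lia.
- by move=> m n mn; rewrite ll'; lia.
- move=> m n; have [->|m0] := eqVneq m 0; first by rewrite lo dos addnC.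
  have dmo : d (l m%:Z) o = m by rewrite -lo ll; lia.
  have [p gp] := gdist_geodesic econn (l' n%:Z) (l m%:Z).
  have [q [wq oq]] := ray n.
  have := cut m%:Z _ m0 (walk_cat wq gp.1).
  rewrite -cat_cons mem_cat (negbTE oq)/= => op.
  have := geodesic_btw econn gp (_ : o \in l' n%:Z :: p).
  rewrite inE op orbT /btw (gdistC esym econn _ o) dos.
  rewrite (gdistC esym econn o (l m%:Z)) dmo.
  by rewrite (gdistC esym econn (l' n%:Z) (l m%:Z)) => /(_ isT); lia.
- by move=> x; rewrite !inE => /eqP->; rewrite eq_sym.
- by move=> x; rewrite inE => /eqP-> n; apply/nesym/lno.
- by move=> x; rewrite inE => /eqP-> n; apply/nesym/lns.
Qed.

Lemma diverging_ex (nb : V -> seq V) o s :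
    (forall x y, (y \in nb x) = e x y) -> infinite_set [set: V] ->
    vertex_transitive e -> s != o ->
  exists al be g p q, diverging o s al be g p q.
Proof.
move=> nbE Vinf etrans so.
have [l ll lo] := line_through esym econn nbE Vinf etrans o.
have [l' ll' ls] := line_through esym econn nbE Vinf etrans s.
have swap : (exists al be g p q, diverging s o al be g p q) ->
    exists al be g p q, diverging o s al be g p q.
  by move=> [al [be [g [p [q /divergingC dv]]]]]; exists be, al, g, q, p.
have [[k lk]|/forallNP lns] := pselect (exists k, l k = s).
  exact: diverging_on_line lk so.
have [[k lk]|/forallNP lno] := pselect (exists k, l' k = o).
  by apply: swap; apply: diverging_on_line lk _; rewrite // eq_sym.
have [[k [q [wq oq]]]|no] := pselect (exists k q, walk e s (l k) q /\ o \notin s :: q).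
  exact: diverging_off_line wq oq.
have [[k [q [wq oq]]]|no'] := pselect (exists k q, walk e o (l' k) q /\ s \notin o :: q).
  by apply: swap; apply: diverging_off_line wq oq.
apply: (diverging_cut so ll lo ll' ls lns lno) => k q _ wq;
  apply: contrapT => /negP nin; [apply: no|apply: no']; by exists k, q.
Qed.

End Diverging.

(** * Passage times and genealogies *)

Section PassageTime.
Context {V : choiceType} {R : realType}.
Implicit Types (w : set V -> R) (x : V) (p : seq V).

Definition path_edges x p : seq (set V) := pairmap (fun u v => [set u; v]) x p.

Definition passage_time w x p : R := \sum_(E <- path_edges x p) w E.

Lemma passage_time_cons w x y p :
  passage_time w x (y :: p) = w [set x; y] + passage_time w y p.
Proof. exact: big_cons. Qed.

Lemma passage_time_rcons w x p y :
  passage_time w x (rcons p y) = passage_time w x p + w [set last x p; y].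
Proof.
elim: p x => [|z p IHp] x.
  by rewrite /= passage_time_cons /passage_time !big_nil addrC.
by rewrite /= !passage_time_cons IHp addrA.
Qed.

Lemma passage_time_ge0 (e : rel V) w : (forall x y, e x y -> 0 < w [set x; y]) ->
  forall x p, path e x p -> 0 <= passage_time w x p.
Proof.
move=> w0 x p; elim: p x => [|y p IHp] x /=; first by rewrite /passage_time big_nil.
by move=> /andP[xy /IHp ?]; rewrite passage_time_cons addr_ge0// ltW// w0.
Qed.

End PassageTime.

Definition opponent (i : fpp_type) := if i is FPP1 then FPPlam else FPP1.

Section Genealogy.
Context {V : choiceType} {R : realType} {e : rel V} {lam : R} {o s : V}.
Hypothesis lam_gt0 : 0 < lam.
Local Notation d := (gdist e).
Context {w : set V -> R}.
Hypothesis w_gt0 : forall x y, e x y -> 0 < w [set x; y].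

(** Long simple paths take long, uniformly over those that start not too far
    from [o] compared with their length. *)
Definition no_explosion := forall B : R, exists N, forall x p,
  path e x p -> uniq (x :: p) -> (N <= size p)%N -> (d o x <= (size p).*2)%N ->
  B < passage_time w x p.

Hypothesis noexp : no_explosion.

Lemma rate_gt0 i : 0 < rate lam i.
Proof. by case: i. Qed.

Definition seed (i : fpp_type) := if i is FPP1 then o else s.

Context {h : history V R}.
Hypothesis rh : richardson e lam o s w h.

Definition occ x : Prop := (occ_time h x < +oo)%E.

Definition otime x : R := fine (occ_time h x).

Lemma otimeE x : occ x -> occ_time h x = (otime x)%:E.
Proof. by move=> ox; rewrite /otime fineK// ge0_fin_numE// (rich_ge0 rh). Qed.

Lemma otime_ge0 x : 0 <= otime x.
Proof. by rewrite fine_ge0// (rich_ge0 rh). Qed.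

Lemma occ_seed i : [/\ occ (seed i), occ_type h (seed i) = i & otime (seed i) = 0].
Proof.
by case: i; rewrite /occ /otime /=; [have [-> ->] := rich_seed1 rh
  | have [-> ->] := rich_seedlam rh].
Qed.

Lemma occ_spread x y : e x y -> occ x ->
  occ y /\ otime y <= otime x + w [set x; y] / rate lam (occ_type h x).
Proof.
move=> xy ox; have := rich_spread rh xy; rewrite /arrival (otimeE ox) -EFinD => le.
have oy : occ y by apply: le_lt_trans le (ltry _).
by split=> //; move: le; rewrite (otimeE oy) lee_fin.
Qed.

(** [x] caught its type from [y]: paths of this relation go back in time, towards
    a seed. *)
Definition parent x y : bool := `[< [/\ e y x, occ x, occ y,
  occ_type h x = occ_type h y &
  otime x = otime y + w [set x; y] / rate lam (occ_type h x)] >].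

Hypothesis esym : symmetric e.

Lemma parent_ex x : occ x -> x != o -> x != s -> exists y, parent x y.
Proof.
move=> ox xo xs; have [y [yx]] := rich_source rh xo xs ox.
rewrite /arrival => xE tE.
have oy : occ y.
  rewrite /occ ltey; apply: contraPneq ox => yE; rewrite /occ xE yE.
  by rewrite addye// ltxx.
exists y; apply/asboolP; split=> //.
by move: xE; rewrite (otimeE ox) (otimeE oy) -EFinD => -[->]; rewrite tE setUC.
Qed.

Lemma parent_path x p : path parent x p -> occ x ->
  [/\ path e x p, uniq (x :: p),
      {in x :: p, forall y, occ y /\ occ_type h y = occ_type h x} &
      otime x = otime (last x p) + passage_time w x p / rate lam (occ_type h x)].
Proof.
move=> pp ox; split.
- apply: sub_path pp => u v /asboolP[vu _ _ _ _]; by rewrite esym.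
- have tr : transitive (fun u v => otime v < otime u).
    by move=> b a c ba cb; apply: lt_trans cb ba.
  have ir : irreflexive (fun u v => otime v < otime u) by move=> a; rewrite ltxx.
  apply: (sorted_uniq tr ir); rewrite /=; apply: sub_path pp => u v.
  move=> /asboolP[vu _ _ _ ->]; rewrite ltrDl divr_gt0 ?rate_gt0//.
  by rewrite setUC w_gt0.
- elim: p x pp ox => [|y p IHp] x /=; first by move=> _ ox z; rewrite inE => /eqP->.
  move=> /andP[/asboolP[_ ox oy txy _] pp] _ z; rewrite inE => /orP[/eqP->//|].
  by rewrite txy; apply: IHp.
- elim: p x pp ox => [|y p IHp] x /=.
    by rewrite /passage_time big_nil mul0r addr0.
  move=> /andP[/asboolP[_ ox oy txy ->] pp] _; rewrite passage_time_cons.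
  by rewrite (IHp _ pp oy) txy mulrDl addrA addrAC.
Qed.

(** Going back from parent to parent ends at a seed: otherwise there would be
    arbitrarily long simple paths to [x], all of them of passage time at most
    the occupation time of [x] up to a factor. *)
Lemma genealogy x : occ x ->
  exists2 p, path parent x p & last x p = seed (occ_type h x).
Proof.
move=> ox.
(* Either the genealogy is complete within [n] steps or it can be continued. *)
have chain n : (exists2 p, path parent x p & last x p = seed (occ_type h x)) \/
    exists2 p, path parent x p & size p = n.
  elim: n => [|n [|[p pp sp]]]; [by right; exists [::]|by left|].
  have [_ _ /(_ _ (mem_last x p))[ol tl] _] := parent_path pp ox.
  have lastP y : last x p = y -> y = seed (occ_type h y) ->
      last x p = seed (occ_type h x).
    by move=> ly yE; rewrite -tl ly.
  have [lo|lo] := eqVneq (last x p) o.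
    left; exists p => //; apply: lastP lo _.
    by have [_ ->] := occ_seed FPP1.
  have [ls|ls] := eqVneq (last x p) s.
    left; exists p => //; apply: lastP ls _.
    by have [_ ->] := occ_seed FPPlam.
  have [y ly] := parent_ex ol lo ls.
  by right; exists (rcons p y); rewrite ?size_rcons ?sp// rcons_path pp.
have [N hN] := noexp (otime x * rate lam (occ_type h x)).
have [//|[p pp sp]] := chain (maxn N (d o x)).
have [pe up _ xE] := parent_path pp ox.
have := hN x p pe up; rewrite sp leq_maxl => /(_ isT).
have dl : (d o x <= (maxn N (d o x)).*2)%N by lia.
move=> /(_ dl); rewrite ltNge xE mulrDl divfK ?gt_eqF ?rate_gt0//.
by rewrite lerDr mulr_ge0// ?otime_ge0// ltW// rate_gt0.
Qed.

(** A type spreads along a path at the speed of its clock, unless the other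
    type gets somewhere on the path even earlier. *)
Lemma spread_along i mu x p : 0 < mu -> mu <= rate lam i ->
    path e x p -> occ x -> occ_type h x = i ->
  (occ (last x p) /\ occ_type h (last x p) = i /\
     otime (last x p) <= otime x + passage_time w x p / mu) \/
  (exists y, [/\ y \in p, occ y, occ_type h y = opponent i &
     otime y <= otime x + passage_time w x p / mu]).
Proof.
move=> mu0 mui; elim: p x => [|y p IHp] x /=.
  by left; do !split=> //; rewrite /passage_time big_nil mul0r addr0.
move=> /andP[xy pp] ox tx; have [oy ty] := occ_spread xy ox.
have pt0 := passage_time_ge0 w_gt0 pp.
have {}ty : otime y <= otime x + w [set x; y] / mu.
  by apply: le_trans ty _; rewrite lerD2l tx ler_pM2l ?w_gt0// lef_pV2// posrE ?rate_gt0.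
have le : otime y + passage_time w y p / mu <=
    otime x + passage_time w x (y :: p) / mu.
  by rewrite passage_time_cons mulrDl addrA lerD2r.
have [tyi|tyi] : occ_type h y = i \/ occ_type h y = opponent i.
  by case: i {mui IHp tx} => /=; case: (occ_type h y); by [left|right].
- have [[ol [tl lel]]|[z [zp oz tz lez]]] := IHp y pp oy tyi.
    by left; do !split=> //; apply: le_trans le.
  right; exists z; split=> //; first by rewrite inE zp orbT.
  exact: le_trans le.
- right; exists y; split; rewrite ?mem_head//.
  by apply: le_trans le; rewrite lerDl divr_ge0// ltW.
Qed.

End Genealogy.

(** * Survival *)

Section Survival.
Context {V : choiceType} {R : realType} {e : rel V} {lam : R} {o s : V}.
Hypotheses (lam_gt0 : 0 < lam) (esym : symmetric e) (econn : connected_graph e).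
Local Notation d := (gdist e).
Local Notation seed := (@seed V o s).
Context {w : set V -> R}.
Hypothesis w_gt0 : forall x y, e x y -> 0 < w [set x; y].
Hypothesis noexp : no_explosion (e := e) (o := o) (w := w).
Context {h : history V R}.
Hypothesis rh : richardson e lam o s w h.
Context {del : nat}.
Hypothesis hthin : thin (e := e) del.
Context {mu Lam eps kap C : R} {r0 L : nat}.
Hypotheses (mu_gt0 : 0 < mu) (mu_rate : forall i, mu <= rate lam i).
Hypotheses (rate_Lam : forall i, rate lam i <= Lam).
Hypotheses (eps_ge0 : 0 <= eps) (C_ge0 : 0 <= C).
Hypothesis fast_core : eps * L%:R / mu < kap / Lam.

(** [core i] is a finite region that type [i] fills at once; [ray i] is a
    geodesic ray from a point deep inside the core. *)
Context {core : fpp_type -> seq V} {ray : fpp_type -> nat -> V}.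
Hypothesis seed_core : forall i, seed i \in core i.
Hypothesis core_disj : forall i x, x \in core i -> x \notin core (opponent i).
Hypothesis core_conn : forall i x, x \in core i -> exists p,
  [/\ walk e (seed i) x p, {subset p <= core i} & (size p <= L)%N].
Hypothesis w_inside : forall i x y, e x y -> x \in core i -> y \in core i ->
  w [set x; y] <= eps.
Hypothesis w_boundary : forall i x y, e x y -> x \notin core i -> y \in core i ->
  kap <= w [set x; y].
Hypothesis w_low : forall i x p y, path e x (rcons p y) -> uniq (x :: rcons p y) ->
  y \in core i -> {in x :: p, forall z k, z \notin core k} ->
  kap * (size p).+1%:R <= passage_time w x (rcons p y).
Hypothesis w_up : forall i x y, e x y ->
  w [set x; y] <= C * (d (ray i 0) x).+1%:R.

Local Notation K := (4 * del)%N.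
Hypothesis ray_geodesic : forall i m n, (m <= n)%N -> d (ray i m) (ray i n) = (n - m)%N.
Hypothesis core_ball : forall i x, (d (ray i 0%N) x <= r0 + 3 * K)%N -> x \in core i.
Hypothesis core_behind : forall i x m n, x \in core (opponent i) -> (m <= n)%N ->
  exists2 u, btw (e := e) x (ray i n) u & (d (ray i m) u <= del)%N.
Hypothesis exp_beats_poly : forall j, (K < j)%N ->
  Lam * (kap / Lam + C * ((3 * j + r0).+1 ^ 2)%:R / mu) <=
    kap * (2 ^ ((r0 + j - K) %/ del - 2))%:R.
Hypothesis r0_big : (2 * del <= r0)%N.
Hypotheses (del_gt0 : (0 < del)%N) (kap_gt0 : 0 < kap).

Local Notation occ := (@occ V R h).
Local Notation otime := (@otime V R h).
Local Notation type := (occ_type h).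

Lemma opponentK : involutive opponent.
Proof. by case. Qed.

Lemma neq_opponent i j : i <> j -> i = opponent j.
Proof. by case: i; case: j. Qed.

Let Lam_gt0 : 0 < Lam.
Proof. exact: lt_le_trans (rate_gt0 lam_gt0 FPP1) (rate_Lam _). Qed.

Lemma path_to_core i x : occ x -> type x = i -> x \notin core i ->
  exists y p, [/\ path e x (rcons p y) /\ uniq (x :: rcons p y), y \in core i,
    {in x :: p, forall z, z \notin core i},
    {in x :: rcons p y, forall z, occ z /\ type z = i} &
    passage_time w x (rcons p y) <= otime x * Lam].
Proof.
move=> ox tx xi; have [p pp lp] := genealogy lam_gt0 w_gt0 noexp rh esym ox.
have [|y [q [pq yi qi [q' qE]]]] := path_first_hit pp (A := mem (core i)) xi.
  by rewrite lp tx /=; apply: seed_core.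
have [pe uq qt xE] := parent_path lam_gt0 w_gt0 esym pq ox.
exists y, q; split=> // [z zin|]; first by have [? ->] := qt z zin.
rewrite xE mulrDl -[leLHS]add0r lerD// ?mulr_ge0 ?(otime_ge0 rh) ?(ltW Lam_gt0)//.
rewrite mulrAC -mulrA ler_peMr ?(passage_time_ge0 w_gt0 pe)//.
by rewrite ler_pdivlMr ?rate_gt0// mul1r rate_Lam.
Qed.
Lemma opponent_enters_core_late i x : occ x -> type x = opponent i -> x \in core i ->
  kap / Lam <= otime x.
Proof.
move=> ox tx xi; have xj := core_disj xi.
have [y [p [[pe _] yj pj _ le]]] := path_to_core ox tx xj.
rewrite ler_pdivrMr//; apply: le_trans le.
rewrite passage_time_rcons; move: pe; rewrite rcons_path => /andP[pe ly].
rewrite -[kap]add0r lerD// ?(passage_time_ge0 w_gt0 pe)//.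
by apply: (w_boundary ly) yj; apply/pj/mem_last.
Qed.

Lemma passage_time_inside i x p : path e x p -> {subset x :: p <= core i} ->
  passage_time w x p <= eps * (size p)%:R.
Proof.
elim: p x => [|y p IHp] x /=; first by rewrite /passage_time big_nil mulr0.
move=> /andP[xy pp] sub; rewrite passage_time_cons -natr1 mulrDr mulr1 addrC lerD//.
  by apply: IHp => // z zin; apply: sub; rewrite inE zin orbT.
by apply: (w_inside (i := i)) => //; apply: sub; rewrite !inE eqxx ?orbT.
Qed.

(** By the time at which an opponent can have left its own core, type [i] has
    run through all of its core. *)
Lemma core_filled i x : x \in core i ->
  [/\ occ x, type x = i & otime x <= kap / Lam].
Proof.
move=> xi; have [p [[pp lp] sub sp]] := core_conn xi.
have [os ts t0] := occ_seed rh i.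
have sub' : {subset seed i :: p <= core i}.
  by move=> z; rewrite inE => /orP[/eqP->|/sub//].
have pt : passage_time w (seed i) p / mu < kap / Lam.
  apply: le_lt_trans fast_core; rewrite ler_pM2r ?invr_gt0//.
  by apply: le_trans (passage_time_inside pp sub') _; rewrite ler_wpM2l// ler_nat.
have [[ol [tl lel]]|[y [yp oy ty ley]]] :=
  spread_along lam_gt0 w_gt0 rh mu_gt0 (mu_rate i) pp os ts.
  by rewrite lp in ol tl lel; split=> //; rewrite (le_trans lel)// t0 add0r ltW.
have := opponent_enters_core_late oy ty (sub _ yp).
by rewrite leNgt (le_lt_trans ley)// t0 add0r.
Qed.

Lemma passage_time_up i n x p : path e x p -> (d (ray i 0) x + size p <= n)%N ->
  passage_time w x p <= (size p)%:R * (C * n.+1%:R).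
Proof.
elim: p x => [|y p IHp] x /=; first by rewrite /passage_time big_nil mul0r.
move=> /andP[xy pp] le; rewrite passage_time_cons -natr1 mulrDl mul1r addrC lerD//.
  apply: IHp => //; have := gdist_triangle econn x (x := ray i 0) (z := y).
  by have := gdist_edge xy; lia.
apply: le_trans (w_up i xy) _; rewrite ler_wpM2l// ler_nat; lia.
Qed.

(** Twice as many steps along the ray as increments of the radius: from an
    outside point that branches off the ray before [ray i (2 * m)], moving on
    from the centre of [cone i m] to a later one loses two units per index,
    while the radius gains only one. *)
Definition cone i j x := (d (ray i (2 * j)) x <= r0 + j)%N.

(** The balls [cone i j] shield each other: an opponent who gets into the
    [j]th one must have come all the way from its own core around the
    ball [cone i (j - K)], which takes a time exponential in [r0 + j].  Type [i]
    needs a quadratic time only: it follows a path of linear length, each edge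
    of which takes a time that is at most linear. *)
Lemma cone_filled i j x : cone i j x -> occ x /\ type x = i.
Proof.
elim/ltn_ind: j x => j IHj x; have [jK|Kj] := leqP j K.
  rewrite /cone => cx; suff /core_filled[] : x \in core i by [].
  apply: core_ball.
  have := gdist_triangle econn (ray i (2 * j)) (x := ray i 0) (z := x).
  by rewrite ray_geodesic//; lia.
rewrite /cone => cx; set n := (3 * j + r0)%N.
have [p [[pp lp] sp pc]] : exists p, [/\ walk e (ray i 0) x p, (size p <= n)%N &
    {in p, forall y, exists2 m, (m <= j)%N & cone i m y}].
  have er m : e (ray i m) (ray i m.+1).
    by apply: gdist1 => //; rewrite ray_geodesic//; lia.
  have wr := path_ray 0 (2 * j) er; set q := map _ _ in wr.
  have [q' gq'] := gdist_geodesic econn (ray i (2 * j)) x.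
  exists (q ++ q'); split; first exact: walk_cat wr gq'.1.
    by rewrite size_cat gq'.2 size_map size_iota /n; lia.
  move=> y; rewrite mem_cat => /orP[/mapP[m + ->]|yq'].
    rewrite mem_iota => mj; exists m./2; first by lia.
    rewrite /cone ray_geodesic; last by lia.
    by move: del_gt0 r0_big; lia.
  exists j => //; rewrite /cone; apply: leq_trans cx.
  have := geodesic_btw econn gq' (_ : y \in _ :: q').
  by rewrite inE yq' orbT /btw => /(_ isT) <-; lia.
have c0 : ray i 0 \in core i by apply: core_ball; rewrite gdistxx.
have [ o0 t0 le0] := core_filled c0.
have [[ol [tl _]]|[y [yp oy ty ley]]] :=
  spread_along lam_gt0 w_gt0 rh mu_gt0 (mu_rate i) pp o0 t0.
  by rewrite lp in ol tl.
exfalso; have ptle : passage_time w (ray i 0) p <= C * (n.+1 ^ 2)%:R.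
  apply: (le_trans (passage_time_up (i := i) (n := n) pp _)).
    by rewrite gdistxx.
  rewrite mulrCA ler_wpM2l// -natrM ler_nat -mulnn leq_mul2r.
  by rewrite (leq_trans sp) ?orbT.
have {ley}ley : otime y * Lam <= kap * (2 ^ ((r0 + j - K) %/ del - 2))%:R.
  apply: le_trans (exp_beats_poly Kj); rewrite mulrC ler_pM2l//.
  by apply: le_trans ley _; rewrite lerD// ler_pM2r ?invr_gt0.
set k := (_ - 2)%N in ley; have kE : (del * (k + 2) <= r0 + j - K)%N.
  have q2 : (2 <= (r0 + j - K) %/ del)%N.
    by rewrite leq_divRL// (leq_trans r0_big)// -addnBA ?leq_addr// ltnW.
  by rewrite /k subnK// mulnC leq_trunc_div.
clearbody k.
have nocone m z : (m < j)%N -> type z = opponent i -> ~~ cone i m z.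
  move=> mj tz; apply/negP => /(IHj _ mj)[_]; rewrite tz.
  by case: (i).
have cy : cone i j y.
  have [m mj cm] := pc y yp; have [<-//|mnej] := eqVneq m j.
  have mltj : (m < j)%N by rewrite ltn_neqAle mnej.
  by move: (nocone m y mltj ty); rewrite cm.
(* The genealogy of [y] up to the opponent's core: before its end it meets
   neither core, so that it is not sped up by the prescribed passage times. *)
have [z [q [qe zc qt sq lq]]] : exists z q, [/\ path e y q, z \in core (opponent i),
    {in y :: q, forall v, type v = opponent i}, (size q <= 2 ^ k)%N & last y q = z].
  have [yc|yc] := boolP (y \in core (opponent i)).
    exists y, [::]; split=> // v; by rewrite mem_seq1 => /eqP->.
  have [z [q [[qe uq] zc qc qt le]]] := path_to_core oy ty yc.
  exists z, (rcons q z); rewrite last_rcons size_rcons; split=> //.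
    by move=> v /qt[].
  have low : kap * (size q).+1%:R <= passage_time w y (rcons q z).
    apply: (w_low qe uq zc) => v vq u.
    have [->|/neq_opponent->] := pselect (u = opponent i); first exact: qc.
    rewrite opponentK; apply/negP => /core_filled[_ tv _].
    have [] := qt v; first by rewrite -rcons_cons mem_rcons inE vq orbT.
    by rewrite tv => _; case: (i).
  have := le_trans low (le_trans le ley).
  by rewrite ler_pM2l// ler_nat.
have jK : (j - K < j)%N by rewrite ltn_subrL !muln_gt0 del_gt0 (leq_ltn_trans _ Kj).
have jK2 : (2 * (j - K) <= 2 * j)%N by rewrite leq_mul2l ltnW.
have [u zu yu] := core_behind zc jK2.
have := branch_or_pass esym econn hthin zu yu qe lq sq.
have far v : v \in y :: q -> (r0 + (j - K) < d (ray i (2 * (j - K))) v)%N.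
  by move=> /qt tv; rewrite ltnNge; apply: nocone.
case=> [|[v vq]]; last first.
  by have := far v vq; clear -kE Kj; lia.
have := far y (mem_head _ _); move: cy; rewrite /cone.
rewrite (gdistC esym econn y) (gdistC esym econn y (ray i (2 * j))).
by rewrite ray_geodesic//; clear -Kj del_gt0; lia.
Qed.

Lemma type_survives i : survives e h i.
Proof.
have ray_in n : final_region h i (ray i n).
  apply: (@cone_filled i n); rewrite /cone (gdistC esym econn) ray_geodesic; lia.
have er m : e (ray i m) (ray i m.+1).
  by apply: gdist1 => //; rewrite ray_geodesic//; lia.
exists (range (ray i)); split.
- by move=> _ [n _ <-].
- apply/infiniteP; rewrite (card_le_eqr (inj_card_eq _))// => m n _ _ mn.
  wlog le : m n mn / (m <= n)%N.
    by move=> wl; case/orP: (leq_total m n) => ?; [|symmetry]; exact: wl.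
  by have := ray_geodesic i le; rewrite mn gdistxx; lia.
- have wr m n : (m <= n)%N ->
      exists2 p, walk e (ray i m) (ray i n) p & [set` ray i m :: p] `<=` range (ray i).
    move=> mn; have := path_ray m (n - m) er; rewrite subnKC// => pr.
    exists [seq ray i k | k <- iota m.+1 (n - m)] => // z /=.
    by rewrite inE => /orP[/eqP->|/mapP[k _ ->]]; [exists m|exists k].
  move=> _ _ [m _ <-] [n _ <-]; case/orP: (leq_total m n) => mn; first exact: wr.
  have [p wp sub] := wr _ _ mn; exists (rev (belast (ray i n) p)).
    exact: walk_rev.
  move=> z /=; rewrite inE mem_rev => /orP[/eqP->|/mem_belast/sub//].
  by exists m.
Qed.


End Survival.

(** * Existence of a history *)

Section Existence.
Context {V : choiceType} {R : realType} {e : rel V} {lam : R} {o s : V}.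
Hypotheses (lam_gt0 : 0 < lam) (esym : symmetric e) (econn : connected_graph e).
Hypotheses (Vinf : infinite_set [set: V]) (so : s != o).
Context {nb : V -> seq V}.
Hypothesis nbE : forall x y, (y \in nb x) = e x y.
Local Notation d := (gdist e).
Context {w : set V -> R}.
Hypothesis w_gt0 : forall x y, e x y -> 0 < w [set x; y].
Hypothesis noexp : no_explosion (e := e) (o := o) (w := w).

Lemma seq_argmin (T : eqType) (f : T -> R) (l : seq T) : l != [::] ->
  exists2 x, x \in l & forall y, y \in l -> f x <= f y.
Proof.
elim: l => // a [|b l] IHl _.
  by exists a; rewrite ?mem_head// => y; rewrite mem_seq1 => /eqP->.
have [x xl xmin] := IHl isT; have [le|lt] := leP (f a) (f x).
  exists a; rewrite ?mem_head// => y; rewrite inE => /orP[/eqP->//|/xmin].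
  exact: le_trans.
exists x => [|y]; first by rewrite inE xl orbT.
by rewrite inE => /orP[/eqP->|/xmin//]; rewrite ltW.
Qed.

Lemma boundary_edge (l : seq V) : l != [::] ->
  exists x y, [/\ x \in l, y \notin l & e x y].
Proof.
case: l => // x l _; set A := x :: l.
have [y yA] : exists y, y \notin A.
  apply: contra_notP Vinf => /forallNP noy.
  apply: (@sub_finite_set _ _ [set` A]); last exact: finite_seq.
  by move=> y _ /=; apply: contrapT => /negP /noy.
have [p [pp lp]] := econn x y.
have [||z [q [pq zA qA _]]] := path_first_hit (A := [pred u | u \notin A]) pp.
- by rewrite /= negbK mem_head.
- by rewrite lp.
exists (last x q), z; split=> //; first by have := qA _ (mem_last x q); rewrite negbK.
by move: pq; rewrite rcons_path => /andP[].
Qed.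

Let clock (b : bool) := if b then FPP1 else FPPlam.

Let entry := (V * (R * bool))%type.

Let reach (z : entry) y : R := z.2.1 + w [set z.1; y] / rate lam (clock z.2.2).

Lemma greedy_step (l : seq entry) : l != [::] -> exists z : entry,
  [/\ exists2 x, x \in l & [/\ e x.1 z.1, z.2.1 = reach x z.1 & z.2.2 = x.2.2],
      z.1 \notin map fst l &
      forall x y, x \in l -> e x.1 y -> y \notin map fst l -> z.2.1 <= reach x y].
Proof.
move=> l0; pose c := [seq (x, y) | x <- l, y <- [seq y <- nb x.1 | y \notin map fst l]].
have cE x y : ((x, y) \in c) = [&& x \in l, e x.1 y & y \notin map fst l].
  apply/allpairsPdep/and3P => [[x' [y' [x'l + [-> ->]]]]|[xl xy yl]].
    by rewrite mem_filter nbE => /andP[].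
  by exists x, y; rewrite mem_filter yl nbE.
have [|[x y] xyc xymin] := seq_argmin (fun xy => reach xy.1 xy.2) (l := c).
  have [|_ [y [/mapP[x xl ->] yl xy]]] := @boundary_edge (map fst l).
    by case: (l) l0.
  by apply/eqP => c0; have := cE x y; rewrite c0 xl xy yl.
move: xyc; rewrite cE => /and3P[xl xy yl]; exists (y, (reach x y, x.2.2)).
split=> //; first by exists x.
by move=> x' y' x'l xy' y'l; apply: (xymin (x', y')); rewrite cE x'l xy'.
Qed.

Record greedy (v : nat -> V) (t : nat -> R) (b : nat -> fpp_type) : Prop := {
  greedy0 : [/\ v 0%N = o, t 0%N = 0 & b 0%N = FPP1] ;
  greedy1 : [/\ v 1%N = s, t 1%N = 0 & b 1%N = FPPlam] ;
  greedy_source : forall n, (1 < n)%N -> exists2 k, (k < n)%N &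
    [/\ e (v k) (v n), t n = t k + w [set v k; v n] / rate lam (b k) & b n = b k] ;
  greedy_new : forall n k, (k < n)%N -> v n <> v k ;
  greedy_min : forall n k y, (1 < n)%N -> (k < n)%N -> e (v k) y ->
    (forall j, (j < n)%N -> y <> v j) -> t n <= t k + w [set v k; y] / rate lam (b k) }.

(** The vertices in the order of their occupation: the next one is reached
    first among all unoccupied neighbours of those occupied so far. *)
Lemma greedy_ex : exists v t b, greedy v t b.
Proof.
have /choice[step stepP] : forall l : seq entry, exists z, l != [::] -> 
  [/\ exists2 x, x \in l & [/\ e x.1 z.1, z.2.1 = reach x z.1 & z.2.2 = x.2.2],
      z.1 \notin map fst l &
      forall x y, x \in l -> e x.1 y -> y \notin map fst l -> z.2.1 <= reach x y].
  move=> [|x l]; first by exists (o, (0, true)).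
  by have [//|z hz] := @greedy_step (x :: l); exists z.
pose seeds : seq entry := [:: (o, (0, true)); (s, (0, false))].
pose pre n := iter n (fun l => rcons l (step l)) seeds.
pose z n := if n is m.+2 then step (pre m) else nth (o, (0, true)) seeds n.
have preE n : pre n = mkseq z n.+2.
  by elim: n => // n IHn; rewrite mkseqS -IHn.
have zP n : (1 < n)%N -> z n = step (mkseq z n) /\ mkseq z n != [::].
  by case: n => [|[|n]] // _; rewrite -preE; split=> //; rewrite preE.
exists (fun n => (z n).1), (fun n => (z n).2.1), (fun n => clock (z n).2.2).
split=> //.
- move=> n n1; have [zn n0] := zP n n1.
  have [[x /mapP[k + ->]]] := stepP _ n0; rewrite -zn mem_iota => kn.
  by case=> zk tz bz _ _; exists k => //; rewrite bz.
- move=> [|[|n]] k kn zk //; first by move: so; case: k kn zk => //= _ ->; rewrite eqxx.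
  have [zn n0] := zP n.+2 isT; have [_ + _] := stepP _ n0.
  rewrite -zn zk => /negP; apply; rewrite -map_comp; apply/mapP.
  by exists k => //; rewrite mem_iota.
- move=> n k y n1 kn zky yn; have [zn n0] := zP n n1.
  have [_ _] := stepP _ n0; rewrite -zn; apply=> //.
    by apply/mapP; exists k => //; rewrite mem_iota.
  by rewrite -map_comp; apply/mapP => -[j + yj]; rewrite mem_iota => /yn.
Qed.

Section Greedy.
Context {v : nat -> V} {t : nat -> R} {b : nat -> fpp_type}.
Hypothesis g : greedy v t b.

Lemma greedy_inj : injective v.
Proof.
move=> m n vmn; have [lt|lt|//] := ltngtP m n.
  by have /nesym := greedy_new g lt.
by have := greedy_new g lt.
Qed.

Let dw_gt0 x y i : e x y -> 0 < w [set x; y] / rate lam i.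
Proof. by move=> xy; rewrite divr_gt0 ?w_gt0 ?rate_gt0. Qed.

Lemma greedy_ge0 n : 0 <= t n.
Proof.
elim/ltn_ind: n => -[|[|n]] IHn.
- by have [_ ->] := greedy0 g.
- by have [_ ->] := greedy1 g.
have [k kn [ekn -> _]] := greedy_source g (isT : 1 < n.+2)%N.
by rewrite addr_ge0 ?IHn// ltW// dw_gt0.
Qed.

Lemma greedy_mono : {homo t : m n / (m <= n)%N >-> m <= n}.
Proof.
apply: homo_leq => [x|y x z|n]; [exact: lexx|exact: le_trans|].
case: n => [|n].
  by have [_ -> _] := greedy0 g; apply: greedy_ge0.
have [k + [ekn tE _]] := greedy_source g (isT : 1 < n.+2)%N.
rewrite ltnS leq_eqVlt => /orP[/eqP kE|kn].
  by subst k; rewrite tE lerDl ltW// dw_gt0.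
case: n kn ekn tE => [|n] kn ekn tE.
  by have [_ -> _] := greedy1 g; apply: greedy_ge0.
rewrite tE; apply: (greedy_min g) => // j jn; apply: (greedy_new g); exact: ltnW.
Qed.

Let Lam := Num.max 1 lam.

Let rate_Lam i : rate lam i <= Lam.
Proof. by rewrite /Lam le_max; case: i; rewrite lexx ?orbT. Qed.

Lemma greedy_path n : exists p,
  [/\ path e (v n) p, {in v n :: p, forall x, exists2 k, (k <= n)%N & x = v k},
      uniq (v n :: p), (last (v n) p \in [:: o; s]) &
      passage_time w (v n) p <= t n * Lam].
Proof.
have base k : (k <= n)%N -> v k \in [:: o; s] -> exists p,
  [/\ path e (v k) p, {in v k :: p, forall x, exists2 j, (j <= k)%N & x = v j},
      uniq (v k :: p), (last (v k) p \in [:: o; s]) &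
      passage_time w (v k) p <= t k * Lam].
  move=> _ vk; exists [::]; split=> //.
    by move=> x; rewrite mem_seq1 => /eqP->; exists k.
  by rewrite /passage_time big_nil mulr_ge0 ?greedy_ge0// le_max ler01.
elim/ltn_ind: n base => -[|[|n]] IHn base.
- by apply: base => //; have [-> _ _] := greedy0 g; rewrite !inE eqxx.
- by apply: base => //; have [-> _ _] := greedy1 g; rewrite !inE eqxx orbT.
have [k kn [ekn -> _]] := greedy_source g (isT : 1 < n.+2)%N.
have [p [pp pk up lp le]] := IHn k kn (fun j jk => base j (leq_trans jk (ltnW kn))).
exists (v k :: p); split.
- by rewrite /= esym ekn.
- move=> x; rewrite inE => /orP[/eqP->|/pk[j jk ->]]; first by exists n.+2.
  by exists j; rewrite // (leq_trans jk)// ltnW.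
- rewrite cons_uniq up andbT; apply/negP => /pk[j jk].
  by apply: (greedy_new g); apply: leq_ltn_trans kn.
- exact: lp.
rewrite passage_time_cons addrC mulrDl lerD// setUC -mulrA ler_peMr//.
  by rewrite ltW// w_gt0.
by rewrite mulrC ler_pdivlMr ?rate_gt0// mul1r rate_Lam.
Qed.

Lemma greedy_unbounded B : exists n, B < t n.
Proof.
apply: contrapT => /forallNP nB.
have tB n : t n <= B by rewrite leNgt; apply/negP/nB.
have [N hN] := noexp (B * Lam).
pose D := (N + (d o s).*2)%N.
(* If the times were bounded, a vertex far from both seeds would have a long
   simple path to a seed whose passage time is bounded. *)
have [n nD] : exists n, (D < d o (v n))%N.
  apply: contrapT => /forallNP nD; have : infinite_set (range v).
    apply/infiniteP; rewrite (card_le_eqr (inj_card_eq _))// => m n _ _.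
    exact: greedy_inj.
  apply.
  apply: (@sub_finite_set _ _ [set` ball nb D o]); last exact: finite_seq.
  by move=> _ [n _ <-] /=; rewrite (mem_ball econn nbE) leqNgt; apply/negP/nD.
have [p [pp _ up lp le]] := greedy_path n.
have sp : (d o (v n) <= d o s + size p)%N.
  have := gdist_min (conj pp erefl : walk e _ _ p).
  rewrite (gdistC esym econn) => vs; move: lp; rewrite !inE => /orP[]/eqP lE.
    by move: vs; rewrite lE; clear; lia.
  have := gdist_triangle econn s (x := o) (z := v n); move: vs; rewrite lE.
  by clear; lia.
have Np : (N <= size p)%N by move: sp nD; rewrite /D; clear; lia.
have dp : (d o (v n) <= (size p).*2)%N by move: sp nD; rewrite /D; clear; lia.
have := hN _ _ pp up Np dp; rewrite ltNge (le_trans le)// ler_wpM2r//.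
by rewrite le_max ler01.
Qed.

(** A neighbour of an occupied vertex has an upper bound on its turn, and
    the times are unbounded. *)
Lemma greedy_surj x : exists n, v n = x.
Proof.
have [p [+ <-]] := econn o x.
have : exists n, v n = o by exists 0%N; have [] := greedy0 g.
elim: p o => [//|z p IHp] y [m vm] /= /andP[yz pp]; apply: IHp pp.
apply: contrapT => /forallNP nz.
have [n nB] := greedy_unbounded (t m + w [set v m; z] / rate lam (b m)).
have := greedy_mono (leq_addr (m + 2) n).
rewrite leNgt => /negP; apply; apply: le_lt_trans nB.
apply: (greedy_min g); rewrite ?vm//; [by clear; lia|by clear; lia|].
by move=> j _ zj; apply: (nz j).
Qed.

Lemma greedy_richardson : exists h, richardson e lam o s w h.
Proof.
have /choice[idx idxK] := greedy_surj.
have vK n : idx (v n) = n by apply: greedy_inj; rewrite idxK.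
exists (History (fun x => (t (idx x))%:E) (fun x => b (idx x))); split=> /=.
- by move=> x; rewrite lee_fin greedy_ge0.
- by have [<- t0 b0] := greedy0 g; rewrite vK t0.
- by have [<- t1 b1] := greedy1 g; rewrite vK t1.
- move=> x y xy; rewrite /arrival /= -EFinD lee_fin.
  rewrite -(idxK x) -(idxK y) !vK; move: (idx x) (idx y) (idxK x) (idxK y) => m n vm vn.
  have [nm|mn] := leqP n m.
    by apply: le_trans (greedy_mono nm) _; rewrite lerDl ltW// dw_gt0// vm vn.
  case: n vn mn => [//|[|n]] vn mn.
    have [_ -> _] := greedy1 g; rewrite addr_ge0 ?greedy_ge0// ltW// dw_gt0//.
    by rewrite vm vn.
  apply: (greedy_min g) => //; first by rewrite vm vn.
  by move=> j; apply: (greedy_new g).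
- move=> y; rewrite -(idxK y) vK; move: (idx y) => n yo ys _.
  have n1 : (1 < n)%N.
    case: n yo ys => [|[|//]]; first by have [->] := greedy0 g; rewrite eqxx.
    by have [->] := greedy1 g; rewrite eqxx.
  have [k kn [ekn tn bn]] := greedy_source g n1; exists (v k).
  by rewrite /arrival /= !vK -EFinD -tn bn.
Qed.

End Greedy.

Lemma richardson_ex : exists h, richardson e lam o s w h.
Proof. by have [v [t [b g]]] := greedy_ex; apply: greedy_richardson g. Qed.

End Existence.

(** * Independent exponential clocks *)

Section UnionBound.
Local Open Scope ereal_scope.
Context d {T : measurableType d} {R : realType} (P : probability T R).
Context {I : choiceType} {D : set I} {X : I -> {RV P >-> R}}.
Hypothesis indep : mutually_independent D X.
Implicit Types (l : seq I) (B : set R).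

Definition all_in l B : set T := \bigcap_(i in [set` l]) (X i @^-1` B).

Lemma measurable_all_in l B : measurable B -> measurable (all_in l B).
Proof.
move=> mB; apply: fin_bigcap_measurable; first exact: finite_seq.
by move=> i _; apply: measurable_funPTI.
Qed.

Context {l0 : seq I} {B0 : I -> set R}.
Hypotheses (ul0 : uniq l0) (l0D : [set` l0] `<=` D).
Hypothesis mB0 : forall i, measurable (B0 i).

Let A0 : set T := \bigcap_(i in [set` l0]) (X i @^-1` B0 i).

Let mA0 : measurable A0.
Proof.
apply: fin_bigcap_measurable; first exact: finite_seq.
by move=> i _; apply: measurable_funPTI.
Qed.

Lemma prob_all_in_le l B (q : R) : uniq l -> [set` l] `<=` D ->
    {in l, forall i, i \notin l0} -> measurable B -> (0 <= q)%R ->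
    {in l, forall i, P (X i @^-1` B) <= q%:E} ->
  P (A0 `&` all_in l B) <= P A0 * (q ^+ size l)%:E.
Proof.
move=> ul lD ll0 mB q0 hq; pose B' i := if i \in l0 then B0 i else B.
have mB' i : measurable (B' i) by rewrite /B'; case: ifP.
have -> : A0 `&` all_in l B = \bigcap_(i in [set` l0 ++ l]) (X i @^-1` B' i).
  apply/seteqP; split=> [x [x0 xl] i /=|x xB].
    rewrite mem_cat /B'; case: ifPn => [il0 _|_]; [exact: x0|exact: xl].
  split=> i /= il; have := xB i; rewrite /B' /= mem_cat il ?orbT /=.
    by apply.
  by rewrite (negbTE (ll0 i il)); apply.
rewrite indep//; last first.
- by move=> i /=; rewrite mem_cat => /orP[/l0D|/lD].
- rewrite cat_uniq ul0 ul andbT; apply/hasPn => i; exact: ll0.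
rewrite big_cat/= /A0 indep//; set p0 := \prod_(i <- l0) _.
have -> : \prod_(i <- l0) P (X i @^-1` B' i) = p0.
  by apply: eq_big_seq => i il0; rewrite /B' il0.
have p00 : 0 <= p0 by rewrite /p0; apply: prode_ge0 => i _.
rewrite lee_wpmul2l// => {p0 p00 ul lD}.
elim: l ll0 hq => [|i l IHl] ll0 hq; first by rewrite big_nil.
rewrite big_cons /= exprS EFinM lee_pmul//.
- by apply: prode_ge0 => ? _.
- by rewrite /B' (negbTE (ll0 i (mem_head _ _))) hq ?mem_head.
- by apply: IHl => j jl; [apply: ll0|apply: hq]; rewrite inE jl orbT.
Qed.

(** A union bound that works conditionally on [A0], although the bad events
    may be many: they only concern clocks outside of [l0], so that [P A0]
    factors out. *)
Lemma union_bound (bad : nat -> seq (seq I * set R * R)) :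
    {in l0, forall i, 0 < P (X i @^-1` B0 i)} ->
    (forall n c, c \in bad n ->
      [/\ uniq c.1.1 /\ [set` c.1.1] `<=` D, {in c.1.1, forall i, i \notin l0},
          measurable c.1.2, (0 <= c.2)%R &
          {in c.1.1, forall i, P (X i @^-1` c.1.2) <= c.2%:E}]) ->
    (forall n, (\sum_(c <- bad n) c.2 ^+ size c.1.1 <= 2^-1 / (2 ^ n.+1)%:R)%R) ->
  exists A, [/\ measurable A, 0 < P A,
    forall x i, A x -> i \in l0 -> B0 i (X i x) &
    forall x n c, A x -> c \in bad n -> exists2 i, i \in c.1.1 & ~ c.1.2 (X i x)].
Proof.
move=> P0 badP sumbad.
have PA0 : 0 < P A0.
  rewrite /A0 indep//; elim: (l0) P0 => [|i l IHl] P0; first by rewrite big_nil.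
  rewrite big_cons mule_gt0 ?P0 ?mem_head//; apply: IHl => j jl.
  by rewrite P0// inE jl orbT.
have PA0fin : P A0 \is a fin_num by rewrite fin_num_measure.
pose p0 := fine (P A0); have p0E : P A0 = p0%:E by rewrite fineK.
have p00 : (0 < p0)%R by rewrite -lte_fin -p0E.
pose U n := A0 `&` \big[setU/set0]_(c <- bad n) all_in c.1.1 c.1.2.
have mU n : measurable (U n).
  apply: measurableI => //; rewrite big_seq; apply: bigsetU_measurable => c cn.
  by apply: measurable_all_in; case: (badP n c cn).
have PU n : P (U n) <= (p0 / 2 / (2 ^ n.+1)%:R)%:E.
  apply: (@le_trans _ _ (p0 * \sum_(c <- bad n) c.2 ^+ size c.1.1)%:E); last first.
    by rewrite lee_fin -mulrA ler_wpM2l// ltW.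
  have := badP n; rewrite /U; elim: (bad n) => [|c s IHs] cs.
    by rewrite !big_nil setI0 measure0 mulr0.
  have [[uc cD] cl0 mc c0 cq] := cs c (mem_head _ _).
  have ms : measurable (\big[setU/set0]_(c <- s) all_in c.1.1 c.1.2).
    rewrite big_seq; apply: bigsetU_measurable => c' c's.
    have /cs[_ _ mc' _ _] : c' \in c :: s by rewrite inE c's orbT.
    exact: measurable_all_in.
  have mcc := measurable_all_in c.1.1 mc.
  rewrite !big_cons setIUr mulrDr EFinD.
  apply: le_trans (measureU2 P (measurableI _ _ mA0 mcc) (measurableI _ _ mA0 ms)) _.
  apply: leeD; last first.
    by apply: IHs => c' c's; apply: cs; rewrite inE c's orbT.
  by rewrite EFinM -p0E prob_all_in_le.
pose W := \bigcup_n U n.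
have mW : measurable W by apply: bigcup_measurable.
have PW : P W <= (p0 / 2)%:E.
  apply: (le_trans (@measure_sigma_subadditive _ _ _ P W U mU mW (@subset_refl _ _))).
  apply: le_trans (lee_nneseries _ (fun n _ => PU n)) _ => //.
  by apply: epsilon_trick0; rewrite divr_ge0// ltW.
exists (A0 `\` W); split.
- exact: measurableD.
- have -> : P (A0 `\` W) = P A0 - P (A0 `&` W).
    by rewrite measureD// ltey_eq PA0fin.
  have -> : A0 `&` W = W by rewrite setIidr// => x [n _ []].
  rewrite sube_gt0; apply: le_lt_trans PW _; rewrite p0E lte_fin.
  by rewrite ltr_pdivrMr// ltr_pMr// ltr1n.
- by move=> x i [xA0 _] il0; apply: xA0.
- move=> x n c [xA0 xW] cn; apply: contrapT => nex; apply: xW; exists n => //.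
  split=> //; rewrite -bigcup_seq; exists c => //= i /= ic.
  by apply: contrapT => nx; apply: nex; exists i.
Qed.

End UnionBound.

Section Exponential.
Context d {T : measurableType d} {R : realType} (P : probability T R).
Context (X : {RV P >-> R}).
Hypothesis Xexp : forall B : set R, measurable B ->
  distribution P X B = exponential_prob 1 B.

Lemma exp_itv0c (b : R) : 0 < b ->
  P (X @^-1` (`[0%R, b]%classic : set R)) = (1 - expR (- b))%:E.
Proof.
move=> b0; have := Xexp (@measurable_itv R `[0%R, b]).
by rewrite exponential_prob_itv0c// mulN1r -EFinB.
Qed.

Lemma exp_itv0c_le (b : R) : 0 < b -> (P (X @^-1` (`[0%R, b]%classic : set R)) <= b%:E)%E.
Proof.
move=> b0; rewrite exp_itv0c// lee_fin lerBlDr addrC -lerBlDr.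
exact: expR_ge1Dx.
Qed.

Lemma exp_itvoc (a b : R) : 0 < a -> a < b ->
  P (X @^-1` (`]a, b]%classic : set R)) = (expR (- a) - expR (- b))%:E.
Proof.
move=> a0 ab; have b0 := lt_trans a0 ab.
have mX (i : interval R) : measurable (X @^-1` [set` i]).
  by apply: measurable_funPTI; apply: measurable_itv.
have -> : X @^-1` (`]a, b]%classic : set R) =
    (X @^-1` (`[0%R, b]%classic : set R)) `\` (X @^-1` (`[0%R, a]%classic : set R)).
  apply/seteqP; split=> x /=; rewrite !in_itv/=.
    move=> /andP[ax xb]; rewrite (ltW (lt_trans a0 ax)) xb/=; split=> //.
    by rewrite leNgt ax.
  by move=> [/andP[x0 ->]] /negP; rewrite x0/= -ltNge => ->.
have sub : X @^-1` (`[0%R, a]%classic : set R) `<=` X @^-1` (`[0%R, b]%classic : set R).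
  by move=> x /=; rewrite !in_itv/= => /andP[-> xa]; rewrite (le_trans xa)// ltW.
rewrite measureD//; last by rewrite ltey_eq fin_num_measure.
rewrite (setIidr sub).
transitivity ((1 - expR (- b))%:E - (1 - expR (- a))%:E)%E.
  by congr (_ - _)%E; exact: exp_itv0c.
by rewrite -EFinB; congr (_%:E); lra.
Qed.

Lemma exp_itvoc_gt0 (a b : R) : 0 < a -> a < b ->
  (0 < P (X @^-1` (`]a, b]%classic : set R)))%E.
Proof. by move=> a0 ab; rewrite exp_itvoc// lte_fin subr_gt0 ltr_expR ltrN2. Qed.

(** Excluding the values below [expR (- c)] makes the clock positive at no cost
    in the order of magnitude. *)
Lemma exp_outside_le (c : R) : 1 <= c ->
  (P (X @^-1` (~` `]expR (- c), c]%classic : set R)) <= (2 * expR (- c))%:E)%E.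
Proof.
move=> c1; have ec : expR (- c) < c.
  by apply: lt_le_trans (c1); rewrite -expR0 ltr_expR oppr_lt0 (lt_le_trans _ c1).
have mX : measurable (X @^-1` (`]expR (- c), c]%classic : set R)).
  by apply: measurable_funPTI; apply: measurable_itv.
rewrite preimage_setC probability_setC//.
rewrite exp_itvoc ?expR_gt0// -EFinB lee_fin.
have := expR_ge1Dx (- expR (- c)); lra.
Qed.

End Exponential.

(** * Good passage times *)

Section PathEdges.
Context {V : choiceType} {R : realType} {e : rel V}.
Implicit Types (w : set V -> R) (x : V) (p : seq V).

Lemma path_edges_sub x p : path e x p -> [set` path_edges x p] `<=` edges e.
Proof.
elim: p x => [|y p IHp] x //= /andP[xy pp] E /=; rewrite inE => /orP[/eqP->|].
  by exists x, y.
exact: IHp.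
Qed.

Lemma path_edgesP x p E : E \in path_edges x p ->
  exists u v, [/\ u \in belast x p, v \in p & E = [set u; v]].
Proof.
elim: p x => [|y p IHp] x //=; rewrite inE => /orP[/eqP->|/IHp[u [v [up vp ->]]]].
  by exists x, y; rewrite !mem_head.
by exists u, v; rewrite !inE up vp !orbT.
Qed.

Lemma path_edges_source x p E : path e x p -> E \in path_edges x p ->
  exists u v, [/\ e u v, u \in belast x p & E = [set u; v]].
Proof.
elim: p x => [|y p IHp] x //= /andP[xy pp].
rewrite inE => /orP[/eqP->|/(IHp _ pp)[u [v [uv up ->]]]].
  by exists x, y; rewrite mem_head.
by exists u, v; rewrite inE up orbT.
Qed.

Lemma uniq_path_edges x p : uniq (x :: p) -> uniq (path_edges x p).
Proof.
elim: p x => [|y p IHp] x //= /andP[xp /IHp ->]; rewrite andbT.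
apply/negP => /path_edgesP[u [v [up vp]]] /seteqP[/(_ x)/= + _].
case=> [|xu|xv]; first by left.
- by move: xp; rewrite xu (mem_belast up).
- by move: xp; rewrite xv inE vp orbT.
Qed.

Lemma size_path_edges x p : size (path_edges x p) = size p.
Proof. exact: size_pairmap. Qed.

Lemma sum_ge_count (I : eqType) (f : I -> R) (a : R) (l : seq I) :
    0 <= a -> {in l, forall i, 0 <= f i} ->
  a * (count (fun i => a <= f i) l)%:R <= \sum_(i <- l) f i.
Proof.
move=> a0; elim: l => [|i l IHl] f0; first by rewrite big_nil mulr0.
rewrite big_cons /= natrD mulrDr lerD//; last first.
  by apply: IHl => j jl; apply: f0; rewrite inE jl orbT.
by case: (leP a (f i)) => [af|_] /=; rewrite ?mulr1// mulr0 f0// mem_head.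
Qed.

End PathEdges.

Section GoodWeights.
Context {V : choiceType} {R : realType} {e : rel V} {nb : V -> seq V} {D : nat}.
Hypotheses (esym : symmetric e) (econn : connected_graph e).
Hypotheses (nbE : forall x y, (y \in nb x) = e x y)
           (nbD : forall x, (size (nb x) <= D)%N).
Local Notation d := (gdist e).
Context d' {T : measurableType d'} {P : probability T R}.
Context {t : set V -> {RV P >-> R}}.
Hypothesis t_iid : iid_exponential1 (edges e) t.

(** There are at most [(2 * D.+1 ^ 3) ^ n] ways to choose a path of length [n]
    that starts within [2 * n] of a given vertex, together with a set of its
    edges.  A set of at least half of the edges is crossed in times at most
    [quick] each with probability at most the [n]th power of the square root of
    [quick], which is [2 ^ n] times smaller than the inverse of that number. *)
Definition quick : R := ((4 * D.+1 ^ 3)%:R^-1) ^+ 2.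

(** A clock exceeds [wait * n] with probability at most [(4 * D.+1) ^- n]. *)
Definition wait : R := (4 * D.+1)%:R.

Lemma quick_gt0 : 0 < quick.
Proof. by rewrite exprn_gt0// invr_gt0 ltr0n muln_gt0 expn_gt0. Qed.

Lemma quick_le1 : quick <= 1.
Proof.
rewrite exprn_ile1// ?invr_ge0// invf_le1 ?ltr0n ?muln_gt0 ?expn_gt0//.
by rewrite ler1n muln_gt0 expn_gt0.
Qed.

Context {core : fpp_type -> seq V} {a : fpp_type -> V} {o : V} {M : nat} {eps : R}.
Hypotheses (eps_gt0 : 0 < eps) (eps_le1 : eps <= 1) (M3 : (3 <= M)%N).
Hypothesis core_disj : forall i x, x \in core i -> x \notin core (opponent i).
Hypothesis core_M : forall i x, x \in core i -> (d o x <= M)%N.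
Hypothesis a_M : forall i, (d o (a i) <= M)%N.

(** The edges whose passage times are prescribed.  The radius [3 * M] leaves a
    margin of [2 * M] around the cores and around the starts [a i] of the rays:
    a path from a core that leaves this region has length at least [M], and
    so is covered by the union bound. *)
Let fin_edges : seq (set V) :=
  undup [seq [set x; y] | x <- ball nb (3 * M) o, y <- nb x].

Let inner (E : set V) : Prop :=
  exists i x y, [/\ x \in core i, y \in core i & E = [set x; y]].

Let range0 (E : set V) : set R :=
  if `[< inner E >] then `]eps / 2, eps]%classic else `]1, 2]%classic.

(** A mask picks the edges of a path that are crossed too fast. *)
Let quick_paths m : seq (seq (set V) * set R * R) :=
  [seq (mask c.2 (path_edges c.1.1 c.1.2), `[0, quick]%classic : set R, quick) |
    c <- [seq c <- [seq (xp, b) |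
          xp <- [seq (x, p) | x <- ball nb (2 * m) o, p <- paths nb m x],
          b <- map val (enum {: m.-tuple bool})] |
      uniq (c.1.1 :: c.1.2) &&
      ((m <= 2 * size (mask c.2 (path_edges c.1.1 c.1.2)))%N &&
       all (fun E => E \notin fin_edges) (mask c.2 (path_edges c.1.1 c.1.2)))]].

Let far_range m : set R := `]expR (- (wait * m.+1%:R)), wait * m.+1%:R]%classic.

Let long_edges m : seq (seq (set V) * set R * R) :=
  [seq ([:: E], ~` far_range m, 2 * expR (- (wait * m.+1%:R))) |
    E <- [seq E <- [seq [set x; y] | x <- ball nb m (a FPP1) ++ ball nb m (a FPPlam),
                                     y <- nb x] | E \notin fin_edges]].

Let bad n := quick_paths (n + M) ++ long_edges (n + M).

Let edge_law E : edges e E -> forall B : set R, measurable B ->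
  distribution P (t E) B = exponential_prob 1 B.
Proof. exact: t_iid.2. Qed.

Lemma fin_edgesP E : E \in fin_edges <->
  exists x y, [/\ (d o x <= 3 * M)%N, e x y & E = [set x; y]].
Proof.
rewrite mem_undup; split=> [/allpairsPdep[x [y [xo xy ->]]]|[x [y [xo xy ->]]]].
  by exists x, y; rewrite -nbE -(mem_ball econn nbE).
by apply/allpairsPdep; exists x, y; rewrite (mem_ball econn nbE) nbE.
Qed.

Lemma bad_ok n c : c \in bad n ->
  [/\ uniq c.1.1 /\ [set` c.1.1] `<=` edges e, {in c.1.1, forall E, E \notin fin_edges},
      measurable c.1.2, (0 <= c.2)%R &
      {in c.1.1, forall E, (P (t E @^-1` c.1.2) <= c.2%:E)%E}].
Proof.
rewrite mem_cat => /orP[/mapP[[[x p] b]]|/mapP[E]].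
- rewrite mem_filter => /andP[/= /andP[up /andP[_ /allP nF]] +] -> /=.
  move=> /allpairsPdep[_ [_ [/allpairsPdep[x' [p' [_ p'in ->]]] _ [xE pE _]]]].
  move: p'in; rewrite -xE -pE (mem_paths nbE) => /andP[pp _].
  have sub : [set` mask b (path_edges x p)] `<=` edges e.
    by move=> E /= /mem_mask; apply: path_edges_sub.
  split=> //; first by split=> //; rewrite mask_uniq// uniq_path_edges.
    exact: ltW quick_gt0.
  by move=> E Eb; apply: exp_itv0c_le quick_gt0; apply: edge_law; apply: sub.
- rewrite mem_filter => /andP[nF /allpairsPdep[x [y [_ xy EE]]]] -> /=.
  have eE : edges e E by exists x, y; rewrite -nbE.
  split=> //.
  + by split=> // E'; rewrite /= mem_seq1 => /eqP->.
  + by move=> E'; rewrite mem_seq1 => /eqP->.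
  + by apply: measurableC; apply: measurable_itv.
  + move=> E'; rewrite mem_seq1 => /eqP->; apply: exp_outside_le.
      exact: edge_law.
    by rewrite -natrM ler1n muln_gt0.
Qed.

Lemma size_allpairs_dep_le (I J K : eqType) (f : I -> J -> K) (l : seq I)
    (g : I -> seq J) n : (forall i, (size (g i) <= n)%N) ->
  (size [seq f i j | i <- l, j <- g i] <= size l * n)%N.
Proof.
move=> gn; rewrite size_allpairs_dep sumnE big_map.
by elim: l => [|i l IHl]; rewrite ?big_nil// big_cons mulSn leq_add.
Qed.

Lemma sum_quick_paths m :
  \sum_(c <- quick_paths m) c.2 ^+ size c.1.1 <= (2 ^+ m)^-1.
Proof.
pose r : R := (4 * D.+1 ^ 3)%:R^-1.
have r0 : 0 <= r by rewrite invr_ge0.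
have r1 : r <= 1.
  by rewrite invf_le1 ?ltr0n ?ler1n ?muln_gt0 ?expn_gt0.
have cardle : (size (quick_paths m) <= (2 * D.+1 ^ 3) ^ m)%N.
  rewrite size_map size_filter; apply: leq_trans (count_size _ _) _.
  have tup : size (map val (enum {: m.-tuple bool})) = (2 ^ m)%N.
    by rewrite size_map -cardE card_tuple card_bool.
  apply: (leq_trans (@size_allpairs_dep_le _ _ _ _ _ _ (2 ^ m) _)).
    by move=> _; rewrite tup.
  rewrite expnMn mulnC leq_mul2l; apply/orP; right.
  apply: (leq_trans (@size_allpairs_dep_le _ _ _ _ _ _ (D.+1 ^ m) _)).
    by move=> x; apply: size_paths.
  rewrite -expnM (mulSn 2) expnD mulnC leq_mul2l; apply/orP; right.
  exact: size_ball.
apply: (@le_trans _ _ (\sum_(c <- quick_paths m) r ^+ m)).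
  rewrite big_seq [leRHS]big_seq; apply: ler_sum => c /mapP[xpb].
  rewrite mem_filter => /andP[/andP[_ /andP[le _]] _] -> /=.
  by rewrite /quick -/r -exprM; apply: ler_wiXn2l.
rewrite big_const_seq count_predT iter_addr_0 -[leLHS]mulr_natl.
apply: (@le_trans _ _ (((2 * D.+1 ^ 3) ^ m)%:R * r ^+ m)).
  by rewrite ler_wpM2r ?exprn_ge0// ler_nat.
rewrite natrX -exprMn -exprVn lerXn2r ?nnegrE ?mulr_ge0//.
rewrite /r ler_pdivrMr ?ltr0n ?muln_gt0 ?expn_gt0//.
by rewrite ler_pdivlMl// -natrM ler_nat mulnA.
Qed.

Lemma sum_long_edges m :
  \sum_(c <- long_edges m) c.2 ^+ size c.1.1 <= (2 ^+ m)^-1.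
Proof.
pose q : R := (4 * D.+1)%:R^-1.
have q0 : 0 <= q by rewrite invr_ge0.
have cardle : (size (long_edges m) <= 2 * D.+1 ^ m.+1)%N.
  rewrite size_map size_filter; apply: leq_trans (count_size _ _) _.
  apply: (leq_trans (@size_allpairs_dep_le _ _ _ _ _ _ D.+1 _)).
    by move=> x; apply: leqW.
  rewrite expnSr mulnA leq_mul2r/= size_cat mulSn mul1n leq_add// size_ball//.
have expq : expR (- (wait * m.+1%:R)) <= q ^+ m.+1.
  rewrite -mulNr expRM_natr lerXn2r ?nnegrE ?expR_ge0//.
  rewrite expRN lef_pV2 ?posrE ?expR_gt0 ?ltr0n//.
  by apply: le_trans (expR_ge1Dx _); rewrite lerDr.
apply: (@le_trans _ _ (\sum_(c <- long_edges m) 2 * q ^+ m.+1)).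
  rewrite big_seq [leRHS]big_seq; apply: ler_sum => c /mapP[E _ ->] /=.
  by rewrite expr1 ler_wpM2l.
rewrite big_const_seq count_predT iter_addr_0 -[leLHS]mulr_natl.
apply: (@le_trans _ _ ((2 * D.+1 ^ m.+1)%:R * (2 * q ^+ m.+1))).
  by rewrite ler_wpM2r ?mulr_ge0 ?exprn_ge0// ler_nat.
rewrite natrM mulrACA natrX -exprMn.
have -> : D.+1%:R * q = 4^-1.
  by rewrite /q natrM invfM mulrCA divff ?mulr1// pnatr_eq0.
rewrite exprS mulrA -natrM divff ?mul1r; last by rewrite pnatr_eq0.
by rewrite -!exprVn lerXn2r ?nnegrE ?invr_ge0// lef_pV2 ?posrE// ler_nat.
Qed.

Lemma sum_bad n :
  \sum_(c <- bad n) c.2 ^+ size c.1.1 <= 2^-1 / (2 ^ n.+1)%:R.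
Proof.
rewrite big_cat /=; apply: le_trans (lerD (sum_quick_paths _) (sum_long_edges _)) _.
rewrite natrX; apply: (@le_trans _ _ (2 * (2 ^+ (n + 3))^-1)).
  have le : (2 ^+ (n + M))^-1 <= (2 ^+ (n + 3))^-1 :> R.
    by rewrite lef_pV2 ?posrE ?exprn_gt0// ler_weXn2l ?ler1n// leq_add2l.
  lra.
rewrite (_ : (n + 3 = n.+1 + 2)%N); last by rewrite addSn addnS.
by rewrite exprD invfM; have := @invr_ge0 R (2 ^+ n.+1); rewrite exprn_ge0//; lra.
Qed.

Lemma range0_gt0 E : E \in fin_edges -> (0 < P (t E @^-1` range0 E))%E.
Proof.
move=> /fin_edgesP[x [y [_ xy EE]]].
have eE : edges e E by exists x, y.
rewrite /range0; case: asboolP => _; apply: exp_itvoc_gt0 (edge_law eE) _ _ _ _ => //.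
- by rewrite divr_gt0.
- by rewrite ltr_pdivrMr// ltr_pMr// ltr1n.
- by rewrite ltr1n.
Qed.

(** All that survival and the existence of a history require from the passage
    times. *)
Record good_weights (w : set V -> R) : Prop := {
  gw_gt0 : forall x y, e x y -> 0 < w [set x; y] ;
  gw_noexp : no_explosion (e := e) (o := o) (w := w) ;
  gw_inside : forall i x y, e x y -> x \in core i -> y \in core i ->
    w [set x; y] <= eps ;
  gw_boundary : forall i x y, e x y -> x \notin core i -> y \in core i ->
    quick / 2 <= w [set x; y] ;
  gw_low : forall i x p y, path e x (rcons p y) -> uniq (x :: rcons p y) ->
    y \in core i -> {in x :: p, forall z k, z \notin core k} ->
    quick / 2 * (size p).+1%:R <= passage_time w x (rcons p y) ;
  gw_up : forall i x y, e x y -> w [set x; y] <= wait * (d (a i) x).+1%:R }.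

Section Deterministic.
Context {w : set V -> R}.
Hypothesis w_range : forall E, E \in fin_edges -> range0 E (w E).
Hypothesis w_good : forall n c, c \in bad n -> exists2 E, E \in c.1.1 & ~ c.1.2 (w E).

Let w_fin E : E \in fin_edges -> 0 < w E <= 2.
Proof.
move=> /w_range; rewrite /range0; case: asboolP => _ /=; rewrite in_itv/= => /andP[w1 w2].
  by rewrite (lt_trans _ w1) ?divr_gt0//= (le_trans w2)// (le_trans eps_le1)// ler1n.
by rewrite (lt_trans _ w1)//.
Qed.

Let w_far i x y : e x y -> [set x; y] \notin fin_edges ->
  far_range (d (a i) x) (w [set x; y]).
Proof.
move=> xy nF; have ox : (3 * M < d o x)%N.
  by rewrite ltnNge; apply: contra nF => ox; apply/fin_edgesP; exists x, y.
pose n := (d (a i) x - M)%N.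
have nE : (n + M = d (a i) x)%N.
  have := gdist_triangle econn (a i) (x := o) (z := x); have := a_M i.
  by rewrite /n; move: ox; clear; lia.
have cbad : ([:: [set x; y]], ~` far_range (n + M),
    2 * expR (- (wait * (n + M).+1%:R))) \in bad n.
  rewrite mem_cat; apply/orP; right; apply/mapP; exists [set x; y] => //.
  rewrite mem_filter nF; apply/allpairsPdep; exists x, y; rewrite nbE; split=> //.
  by rewrite mem_cat nE; case: (i); rewrite !(mem_ball econn nbE) leqnn ?orbT.
have [E] := w_good cbad; rewrite /= mem_seq1 => /eqP-> /contrapT.
by rewrite nE.
Qed.

Let w_pos x y : e x y -> 0 < w [set x; y].
Proof.
move=> xy; have [/w_fin/andP[]//|nF] := boolP ([set x; y] \in fin_edges).
have := w_far FPP1 xy nF; rewrite /far_range /= in_itv/= => /andP[+ _].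
by apply: lt_trans; apply: expR_gt0.
Qed.

Let low E := (E \notin fin_edges) && (w E <= quick).

Let few_low x p : path e x p -> uniq (x :: p) -> (M <= size p)%N ->
  (d o x <= (size p).*2)%N -> (2 * count low (path_edges x p) < size p)%N.
Proof.
move=> pp upx Mp dx; set m := size p in Mp dx *; rewrite ltnNge; apply/negP => le.
set es := path_edges x p in le *; pose b := map low es.
have bs : size b == m by rewrite size_map size_path_edges.
have cbad : (mask b es, `[0, quick]%classic : set R, quick) \in bad (m - M)%N.
  rewrite mem_cat /bad subnK//; apply/orP; left.
  apply/mapP; exists ((x, p), b) => //; rewrite mem_filter /=.
  rewrite -filter_mask size_filter; apply/andP; split.
    move: (upx) => /= ->; rewrite le /=; apply/allP => E; rewrite mem_filter => /andP[].
    by case/andP.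
  apply/allpairsPdep; exists (x, p), b; split=> //.
    apply/allpairsPdep; exists x, p.
    by rewrite (mem_ball econn nbE) (mem_paths nbE) pp /m eqxx mul2n.
  by apply/mapP; exists (Tuple bs); rewrite ?mem_enum.
have [E /=] := w_good cbad; rewrite -filter_mask mem_filter => /andP[/andP[_ Es] Ein].
apply; rewrite in_itv/= Es andbT.
by have [u [v [_ _ EE]]] := path_edgesP Ein; have [u' [v' [uv ->]]] :=
  path_edges_sub pp Ein; rewrite ltW ?w_pos.
Qed.

Let path_pos x p : path e x p -> {in path_edges x p, forall E, 0 <= w E}.
Proof.
by move=> pp E /(path_edges_sub pp)[u [v [uv ->]]]; rewrite ltW ?w_pos.
Qed.

Let boundary_ge1 E : E \in fin_edges -> ~ inner E -> 1 <= w E.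
Proof.
move=> /w_range; rewrite /range0; case: asboolP => // _; rewrite /= in_itv/=.
by move=> /andP[/ltW].
Qed.

Let near_fin x y : e x y -> (d o x <= 3 * M)%N -> [set x; y] \in fin_edges.
Proof. by move=> xy ox; apply/fin_edgesP; exists x, y. Qed.

Let quick2 : quick / 2 <= 1.
Proof. by rewrite ler_pdivrMr// mul1r (le_trans quick_le1)// ler1n. Qed.

Lemma good_weightsI : good_weights w.
Proof.
have up x p y i : path e x (rcons p y) -> y \in core i ->
    (d o x <= M + (size p).+1)%N.
  move=> pp yi; have := gdist_triangle econn y (x := o) (z := x).
  rewrite (gdistC esym econn y); have := gdist_min (conj pp erefl : walk e _ _ _).
  by rewrite last_rcons size_rcons; have := core_M yi; clear; lia.
split=> //.
- move=> B; pose f := size fin_edges.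
  pose N := (2 * (f + Num.bound (`|B| / quick)))%N.
  exists (maxn M N) => x p pp upth; rewrite geq_max => /andP[Mp Np] dx.
  have few := few_low pp upth Mp dx; set es := path_edges x p in few.
  have inF : (count (mem fin_edges) es <= f)%N.
    rewrite -size_filter; apply: uniq_leq_size.
      by rewrite filter_uniq// uniq_path_edges.
    by move=> E; rewrite mem_filter => /andP[].
  have cnt : (size es <= count low es + count (mem fin_edges) es +
      count (fun E => quick <= w E)%R es)%N.
    rewrite /low; elim: (es) => //= E s IHs.
    have := le_total (w E) quick; move: IHs; clear.
    by case: (E \in fin_edges); case: (w E <= quick); case: (quick <= w E) => //=; lia.
  have se : size es = size p by rewrite size_path_edges.
  apply: lt_le_trans (sum_ge_count (ltW quick_gt0) (path_pos pp)).
  rewrite -ltr_pdivrMl ?quick_gt0// mulrC.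
  apply: le_lt_trans (_ : `|B| / quick < _).
    by rewrite ler_pM2r ?invr_gt0 ?quick_gt0// ler_norm.
  apply: lt_le_trans (archi_boundP _) _.
    by rewrite divr_ge0// ltW// quick_gt0.
  rewrite ler_nat -/es -[leqRHS]/(count (fun E : set V => quick <= w E) es).
  by move: few inF cnt Np; rewrite se /N; clear; lia.
- move=> i x y xy xi yi; have Ein : inner [set x; y] by exists i, x, y.
  have /w_range : [set x; y] \in fin_edges.
    by apply: near_fin => //; have := core_M xi; clear; lia.
  rewrite /range0; case: asboolP => // _; rewrite /= in_itv/=.
  by move=> /andP[].
- move=> i x y xy xi yi; apply: le_trans quick2 _; apply: boundary_ge1.
    apply: near_fin => //; have := up x [::] y i; rewrite /= xy => /(_ isT yi).
    by move: M3; clear; lia.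
  move=> [j [u [v [uj vj /seteqP[sub _]]]]].
  have inj z : [set x; y] z -> z \in core j by move=> /sub[->|->].
  have xj := inj x (or_introl erefl); have yj := inj y (or_intror erefl).
  have [ij|/neq_opponent ij] := pselect (i = j); first by rewrite ij xj in xi.
  by have := core_disj yj; rewrite -ij yi.
- move=> i x p y pp upth yi pc; have xle := up _ _ _ _ pp yi.
  have ninner E : E \in path_edges x (rcons p y) -> ~ inner E.
    move=> /path_edgesP[u [v [+ _ ->]]] [j [u' [v' [uj vj /seteqP[/(_ u) sub _]]]]].
    rewrite belast_rcons => ux; have /negP := pc u ux j; apply.
    by case: sub => [|->|->]; first left.
  pose es := path_edges x (rcons p y).
  have ge_quick : (size p).+1%:R <= 2 * (count (fun E => quick <= w E) es)%:R :> R.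
    rewrite -natrM ler_nat; have [Mp|pM] := leqP M (size p).+1.
      have := few_low pp upth; rewrite size_rcons => /(_ Mp).
      have dx : (d o x <= (size p).+1.*2)%N by move: xle Mp; clear; lia.
      move=> /(_ dx); have cnt : (size es <= count low es +
          count (fun E => quick <= w E)%R es)%N.
        have sub E : E \in es -> ~~ low E -> quick <= w E.
          move=> Ein; rewrite /low negb_and negbK => /orP[EF|]; last first.
            by rewrite -ltNge => /ltW.
          by apply: le_trans quick_le1 (boundary_ge1 EF (ninner E Ein)).
        rewrite -(count_predC low es) leq_add2l -!size_filter.
        apply: uniq_leq_size; first by rewrite filter_uniq// uniq_path_edges.
        by move=> E; rewrite !mem_filter => /andP[/= nl Ein]; rewrite Ein sub.
      move: cnt; rewrite -/es size_path_edges size_rcons; clear; lia.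
    suff -> : count (fun E => quick <= w E) es = size es.
      by rewrite size_path_edges size_rcons; clear; lia.
    apply/eqP; rewrite -all_count; apply/allP => E Ein.
    apply: le_trans quick_le1 (boundary_ge1 _ (ninner E Ein)).
    have [u [v [uv + ->]]] := path_edges_source pp Ein.
    rewrite belast_rcons => ux; apply: near_fin uv _.
    have := gdist_triangle econn x (x := o) (z := u).
    have : (d x u <= size p)%N.
      have pp' : path e x p by move: pp; rewrite rcons_path => /andP[].
      case/splitPl: ux pp' => p1 p2 lp1; rewrite cat_path size_cat => /andP[pp1 _].
      have := gdist_min (conj pp1 lp1 : walk e _ _ _); clear; lia.
    by move: xle pM; clear; lia.
  apply: le_trans (sum_ge_count (ltW quick_gt0) (path_pos pp)).
  rewrite mulrAC -mulrA ler_pM2l ?quick_gt0// ler_pdivrMr//.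
  by rewrite mulrC.
- move=> i x y xy; have [/w_fin/andP[_ w2]|nF] := boolP ([set x; y] \in fin_edges).
    apply: le_trans w2 _; rewrite -natrM ler_nat.
    by rewrite mulnS; clear; lia.
  by have := w_far i xy nF; rewrite /far_range /= in_itv/= => /andP[].
Qed.

End Deterministic.

Lemma good_weights_ex : exists A, [/\ measurable A, (0 < P A)%E &
  forall x, A x -> good_weights (fun E => t E x)].
Proof.
have [||A [mA PA Ar Ab]] := union_bound t_iid.1 (undup_uniq _ : uniq fin_edges) _ _
  range0_gt0 bad_ok sum_bad.
- by move=> E /= /fin_edgesP[x [y [_ xy ->]]]; exists x, y.
- by move=> E; rewrite /range0; case: ifP => _; apply: measurable_itv.
exists A; split=> // x Ax; apply: good_weightsI => [E|n c].
  exact: Ar.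
exact: Ab.
Qed.

End GoodWeights.

(** * The initial configuration *)

Section Cores.
Local Open Scope nat_scope.
Context {V : choiceType} {e : rel V} {nb : V -> seq V} {del : nat}.
Hypotheses (esym : symmetric e) (econn : connected_graph e).
Hypothesis nbE : forall x y, (y \in nb x) = e x y.
Hypothesis hthin : thin (e := e) del.
Local Notation d := (gdist e).

(** A trajectory to a far point of a ray, and a ball around that point. *)
Definition core_of (o : V) (p : seq V) (al : nat -> V) (A rho : nat) : seq V :=
  (o :: p) ++ map al (iota 0 A.+1) ++ ball nb rho (al A).

Lemma core_ofP o p al A rho x :
  reflect [\/ x \in o :: p, exists2 k, k <= A & x = al k | d (al A) x <= rho]
    (x \in core_of o p al A rho).
Proof.
rewrite !mem_cat (mem_ball econn nbE) orbA; apply: (iffP idP).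
  move=> /orP[/orP[|/mapP[k + ->]]|]; [by constructor 1| |by constructor 3].
  by rewrite mem_iota => kA; constructor 2; exists k.
case=> [->//|[k kA ->]|->]; last by rewrite orbT.
by rewrite map_f ?orbT// mem_iota.
Qed.

Variables (o s : V) (al be : nat -> V) (g : nat) (p q : seq V) (A rho : nat).
Hypothesis dv : diverging (e := e) o s al be g p q.
Hypothesis A_big : size p + size q + rho + del < A.

Local Notation core1 := (core_of o p al A rho).
Local Notation core2 := (core_of s q be A rho).

Lemma walk_prefix_dist x y r u : walk e x y r -> u \in x :: r -> d u y <= size r.
Proof.
move=> [pr lr] ux; case/splitPl: ux pr lr => r1 r2 lr1.
rewrite cat_path last_cat lr1 size_cat => /andP[_ pr2] lr2.
by have := gdist_min (conj pr2 lr2 : walk e u y r2); lia.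
Qed.

Lemma core_disjoint x : x \in core1 -> x \notin core2.
Proof.
have np u : u \in o :: p -> d u (al 0) <= size p := walk_prefix_dist (div_p dv).
have nq u : u \in s :: q -> d u (be 0) <= size q := walk_prefix_dist (div_q dv).
have tri k l u : k + l + g <= d (al k) u + d u (be l).
  by rewrite -(div_al_be dv); apply: gdist_triangle.
have g0 := div_gt0 dv.
case/core_ofP => [xp|[k kA xk]|xA]; apply/negP => /core_ofP[xq|[l lA xl]|xB].
- by have := div_pq dv xp; rewrite xq.
- exact: (div_p_be dv xp xl).
- have := tri 0 A x; have := np _ xp.
  by rewrite (gdistC esym econn (al 0)) (gdistC esym econn x (be A)); lia.
- exact: (div_q_al dv xq xk).
- by have := tri k l x; rewrite -xk -xl gdistxx; lia.
- by have := tri k A x; rewrite -xk gdistxx (gdistC esym econn x (be A)); lia.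
- by have := tri A 0 x; have := nq _ xq; lia.
- by have := tri A l x; rewrite -xl gdistxx; lia.
- by have := tri A A x; rewrite (gdistC esym econn x (be A)); lia.
Qed.

Lemma core_connected x : x \in core1 -> exists r,
  [/\ walk e o x r, {subset r <= core1} & size r <= size p + A + rho].
Proof.
have er m : e (al m) (al m.+1).
  by apply: gdist1 => //; rewrite (div_al dv)//; lia.
have inp u : u \in p -> u \in core1.
  by move=> up; apply/core_ofP; constructor 1; rewrite inE up orbT.
have way k : k <= A -> exists r,
    [/\ walk e o (al k) r, {subset r <= core1} & size r <= size p + k].
  move=> kA; have wr := path_ray 0 k er.
  exists (p ++ map al (iota 1 k)); split; first exact: walk_cat (div_p dv) wr.
    move=> u; rewrite mem_cat => /orP[/inp//|/mapP[j + ->]].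
    by rewrite mem_iota => jk; apply/core_ofP; constructor 2; exists j => //; lia.
  by rewrite size_cat size_map size_iota.
case/core_ofP => [xp|[k kA ->]|dx].
- have [pp lp] := div_p dv; case/splitPl: xp inp pp lp => p1 p2 lp1 inp.
  rewrite cat_path => /andP[pp1 _] _; exists p1; split=> //.
    by move=> u up1; apply: inp; rewrite mem_cat up1.
  by rewrite size_cat; lia.
- by have [r [wr sub sr]] := way k kA; exists r; split=> //; lia.
- have [r [wr sub sr]] := way A (leqnn A).
  have [r' gr'] := gdist_geodesic econn (al A) x.
  exists (r ++ r'); split; first exact: walk_cat wr gr'.1.
    move=> u; rewrite mem_cat => /orP[/sub//|ur']; apply/core_ofP; constructor 3.
    have := geodesic_btw econn gr' (_ : u \in al A :: r').
    by rewrite inE ur' orbT /btw => /(_ isT); lia.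
  by rewrite size_cat gr'.2; lia.
Qed.

(** The opponent's core is near the other ray, which points away from [al]. *)
Lemma core_is_behind x m n :
    x \in core2 -> m <= n ->
  exists2 u, btw (e := e) x (al (A + n)) u & d (al (A + m)) u <= del.
Proof.
move=> xin mn.
have [k xk] : exists k, d x (be k) <= size q + rho.
  case/core_ofP: xin => [xq|[k _ ->]|xA].
  - by exists 0; rewrite (leq_trans (walk_prefix_dist (div_q dv) xq)) ?leq_addr.
  - by exists k; rewrite gdistxx.
  - by exists A; rewrite (gdistC esym econn) (leq_trans xA) ?leq_addl.
have dba l : d (be k) (al l) = l + k + g.
  by rewrite (gdistC esym econn) (div_al_be dv).
apply: (behind_of_near esym econn hthin (b := be k)); rewrite /btw !dba.
  by rewrite (div_al dv); lia.
by lia.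
Qed.

End Cores.

Lemma exp_beats_square (Q : nat) : exists v0, forall v, (v0 <= v)%N ->
  (Q * v.+1 ^ 2 <= 2 ^ (v - 2))%N.
Proof.
(* With [w := v %/ 4] the left side is at most [16 * Q * w.+1 ^ 2], whereas
   [2 ^ v] is at least [w.+1 ^ 4]. *)
exists (4 * (64 * Q).+1)%N => v; set w := (v %/ 4)%N => vQ.
have wQ : (64 * Q < w)%N by rewrite /w leq_divRL// mulnC.
have v1 : (v.+1 <= 4 * w.+1)%N.
  by rewrite mulnC ltn_ceil.
have v2 : (4 * w <= v)%N by rewrite mulnC leq_trunc_div.
have w2 : (w.+1 <= 2 ^ w)%N by apply: ltn_expl.
suff : (4 * (Q * v.+1 ^ 2) <= 2 ^ v)%N.
  have -> : (2 ^ v = 4 * 2 ^ (v - 2))%N.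
    by rewrite -[4%N]/(2 ^ 2)%N -expnD subnKC//; lia.
  by rewrite leq_mul2l.
apply: (@leq_trans (w.+1 ^ 4)); last first.
  apply: leq_trans (leq_pexp2l _ v2) => //.
  by rewrite mulnC expnM leq_exp2r.
apply: (@leq_trans (4 * (Q * (4 * w.+1) ^ 2))).
  by rewrite !leq_mul2l /= leq_exp2r ?v1 ?orbT.
rewrite expnMn -[(w.+1 ^ 4)%N]/(w.+1 ^ (2 + 2))%N expnD !mulnA leq_mul2r.
by apply/orP; right; rewrite -mulnn; nia.
Qed.

Section Numerics.
Context {R : realType}.

(** How large the initial advantage [r0] has to be: this only depends on the
    graph and on the speeds. *)
Lemma advantage_ex (del : nat) (kap Lam C mu : R) :
    (0 < del)%N -> 0 < kap -> 0 < Lam -> 0 <= C -> 0 < mu ->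
  exists r0, (2 * del <= r0)%N /\ forall j, (4 * del < j)%N ->
    Lam * (kap / Lam + C * ((3 * j + r0).+1 ^ 2)%:R / mu) <=
      kap * (2 ^ ((r0 + j - 4 * del) %/ del - 2))%:R.
Proof.
move=> del0 kap0 Lam0 C0 mu0; pose K := (4 * del)%N.
pose B := (3 * del + 3 * K + 1)%N.
pose c := Lam * C * (B ^ 2)%:R / (mu * kap).
have c0 : 0 <= c by rewrite divr_ge0 ?mulr_ge0// ltW.
have [v0 hv0] := exp_beats_square (Num.bound c).+1.
exists (del * (v0 + 2))%N; split; first by rewrite mulnC leq_mul2l leq_addl orbT.
move=> j Kj; set r0 := (del * _)%N; set u := (r0 + j - 4 * del)%N.
set v := (u %/ del)%N.
have vv0 : (v0 <= v)%N.
  rewrite /v leq_divRL// mulnC /u -addnBA ?(ltnW Kj)//.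
  by rewrite (leq_trans _ (leq_addr _ _))// leq_mul2l leq_addr orbT.
have le : ((3 * j + r0).+1 <= B * v.+1)%N.
  have uv : (u < del * v.+1)%N by rewrite mulnC ltn_ceil.
  have ju : (3 * j + r0 <= 3 * u + 3 * K)%N by rewrite /u /K; move: Kj; clear; lia.
  have -> : (B * v.+1 = 3 * (del * v.+1) + 3 * (K * v.+1) + v.+1)%N.
    by rewrite /B; clear; nia.
  have := leq_pmulr K (ltn0Sn v); move: uv ju.
  by move: (del * v.+1)%N (K * v.+1)%N => n m; clear; lia.
rewrite mulrDr mulrCA divff ?mulr1; last by rewrite gt_eqF.
apply: (@le_trans _ _ (kap * (1 + c * (v.+1 ^ 2)%:R))).
  rewrite mulrDr mulr1 lerD2l /c.
  have -> : kap * (Lam * C * (B ^ 2)%:R / (mu * kap) * (v.+1 ^ 2)%:R) =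
      Lam * (C * ((B * v.+1) ^ 2)%:R / mu).
    rewrite expnMn natrM; field.
    by rewrite !gt_eqF.
  by rewrite ler_wpM2l ?(ltW Lam0)// ler_wpM2r ?invr_ge0 ?(ltW mu0)// ler_wpM2l//
    ler_nat leq_exp2r.
rewrite ler_pM2l//; apply: (@le_trans _ _ (((Num.bound c).+1 * v.+1 ^ 2)%N%:R)).
  rewrite mulSn natrD lerD// ?ler1n ?expn_gt0//.
  by rewrite natrM ler_wpM2r// ltW// archi_boundP.
by rewrite ler_nat hv0.
Qed.

End Numerics.

(** * Coexistence *)

Unset Implicit Arguments.

Theorem corollary1p5 (R : realType) (V : choiceType) (e : rel V)
    (Vinfinite : infinite_set [set: V])
    (esimple : simple_graph e)
    (econnected : connected_graph e)
    (etransitive : vertex_transitive e)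
    (ehyperbolic : hyperbolic e R)
    (edegree : bounded_degree e)
    (o s : V) (so : s != o)
    (lam : R) (lam_gt0 : 0 < lam)
    (d : measure_display) (T : measurableType d) (P : probability T R)
    (t : set V -> {RV P >-> R})
    (t_iid : iid_exponential1 (edges e) t) :
  positive_probability P
    [set omega : T | both_survive e lam o s (fun E : set V => t E omega)].
Proof.
have esym := esimple.1.
have [del del0 hthin] := hyperbolic_thin econnected ehyperbolic.
have [nb [D [nbE nbD]]] := bounded_degree_nbr edegree.
have [al [be [g [p [q dv]]]]] :=
  diverging_ex esym econnected nbE Vinfinite etransitive so.
have dv' := divergingC esym econnected dv.
pose Lam := Num.max 1 lam; pose mu := Num.min 1 lam; pose kap : R := @quick R D / 2.
have kap0 : 0 < kap by rewrite divr_gt0 ?quick_gt0.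
have Lam0 : 0 < Lam by rewrite lt_max ltr01.
have mu0 : 0 < mu by rewrite lt_min ltr01.
have mu_rate i : mu <= rate lam i by rewrite /mu ge_min; case: i; rewrite lexx ?orbT.
have rate_Lam i : rate lam i <= Lam by rewrite /Lam le_max; case: i; rewrite lexx ?orbT.
have C0 : 0 <= @wait R D by exact: ler0n.
have [r0 [r0_big hr0]] := advantage_ex del0 kap0 Lam0 C0 mu0.
(* The order of the choices matters: [r0] depends on the graph and the speeds
   only, the position [A] of the balls on [r0], and the speed [eps] inside of
   the cores on their size. *)
pose rho := (r0 + 3 * (4 * del))%N.
pose A := (size p + size q + rho + del).+1.
pose core i := if i is FPP1 then core_of (nb := nb) o p al A rho
  else core_of (nb := nb) s q be A rho.
pose ray i n := if i is FPP1 then al (A + n)%N else be (A + n)%N.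
pose L := (size p + size q + A + rho)%N.
have Apq : (size p + size q + rho + del < A)%N by [].
have Aqp : (size q + size p + rho + del < A)%N by rewrite (addnC (size q)).
pose eps : R := Num.min 1 (kap / Lam * mu / L.+1%:R).
have eps0 : 0 < eps by rewrite lt_min ltr01 !(divr_gt0, mulr_gt0).
have fast : eps * L%:R / mu < kap / Lam.
  rewrite ltr_pdivrMr//; apply: (@lt_le_trans _ _ (eps * L.+1%:R)).
    by rewrite ltr_pM2l// ltr_nat.
  by rewrite -ler_pdivlMr// /eps ge_min lexx orbT.
have disj i x : x \in core i -> x \notin core (opponent i).
  by case: i; [apply: (core_disjoint esym econnected nbE dv Apq)
    |apply: (core_disjoint esym econnected nbE dv' Aqp)].
have conn i x : x \in core i -> exists r,
    [/\ walk e (seed (o := o) (s := s) i) x r, {subset r <= core i} & (size r <= L)%N].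
  case: i => [/(core_connected econnected nbE dv Apq)
             |/(core_connected econnected nbE dv' Aqp)];
    by move=> [r [wr sub sr]]; exists r; split=> //; rewrite /L; move: sr; clear; lia.
have seed_core i : seed (o := o) (s := s) i \in core i.
  by case: i; rewrite /core /core_of mem_cat mem_head.
have ray_geo i m n : (m <= n)%N -> gdist e (ray i m) (ray i n) = (n - m)%N.
  by move=> mn; case: i; rewrite /ray ?(div_al dv) ?(div_be dv) ?leq_add2l// subnDl.
have core_ball i x : (gdist e (ray i 0%N) x <= rho)%N -> x \in core i.
  by case: i; rewrite /ray addn0 => dx; apply/(core_ofP econnected nbE); constructor 3.
have behind i x m n : x \in core (opponent i) -> (m <= n)%N ->
    exists2 u, btw (e := e) x (ray i n) u & (gdist e (ray i m) u <= del)%N.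
  by case: i; [apply: (core_is_behind esym econnected nbE hthin dv Apq)
    |apply: (core_is_behind esym econnected nbE hthin dv' Aqp)].
pose M := (3 + \max_(x <- core FPP1 ++ core FPPlam) gdist e o x)%N.
have core_M i x : x \in core i -> (gdist e o x <= M)%N.
  move=> xi; rewrite (leq_trans _ (leq_addl _ _))//.
  apply: (@leq_bigmax_seq _ (core FPP1 ++ core FPPlam) xpredT (gdist e o) x) => //.
  by rewrite mem_cat; case: i xi => ->; rewrite ?orbT.
have ray_M i : (gdist e o (ray i 0%N) <= M)%N.
  by apply: (core_M i); apply: core_ball; rewrite gdistxx.
have eps1 : eps <= 1 by rewrite ge_min lexx.
have [B [mB PB goodB]] := good_weights_ex esym econnected nbE nbD t_iid
  eps0 eps1 (leq_addr _ _ : (3 <= M)%N) disj core_M ray_M.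
exists B; split=> // omega /goodB good.
split; first exact: (richardson_ex lam_gt0 esym econnected Vinfinite so nbE
  (gw_gt0 good) (gw_noexp good)).
move=> h rh; have surv i : survives e h i.
  exact: (type_survives lam_gt0 esym econnected (gw_gt0 good) (gw_noexp good) rh
    hthin mu0 mu_rate rate_Lam (ltW eps0) C0 fast seed_core disj conn
    (gw_inside good) (gw_boundary good) (gw_low good) (gw_up good) ray_geo
    core_ball behind hr0 r0_big del0 kap0).
by split; apply: surv.
Qed.
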